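(* Let $(\mathbb{P}_n)_{n\in\mathbb{N}}$ be a sequence of probability measures on $(\mathbf{D},\mathcal{F})$ under which the coordinate process $X$ has the decomposition $$X=M^n+A^n,$$ where $M^n$ is a cadlag $\mathbb{P}_n$-martingale and $A^n$ is an adapted process with locally finite variation. Suppose further that for every $t\in\mathbb{R}_+$ the sequence (indexed by $n$) $$\mathbb{E}_{\mathbb{P}_n}\left[|X_t|\right]+\mathbb{E}_{\mathbb{P}_n}\left[\int_0^t|dA^n_s|\right]$$ is finite and bounded. Then there exist a subsequence $(\mathbb{P}_{n_k})_{k\in\mathbb{N}}$ and a probability measure $\mathbb{P}$ on $(\mathbf{D},\mathcal{F})$ such that $\mathbb{P}_{n_k}\rightarrow\mathbb{P}$ in the sense of finite-dimensional distributions almost everywhere on $\mathbb{R}_+$.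
   Context: $\mathbf{D}$ is the set of cadlag functions $\omega:\mathbb{R}_+\rightarrow\mathbb{R}$; $X_t(\omega)=\omega(t)$ is the coordinate process; $\mathcal{F}=\sigma(X_t:t\in\mathbb{R}_+)$; $\mathcal{F}_t=\sigma(X_s:s\in[0,t])$. Martingales and adaptedness are with respect to the natural filtration $(\mathcal{F}_t)$. $\int_0^t|dA^n_s|$ denotes the variation of $A^n$ over $[0,t]$. For $S\subseteq\mathbb{R}_+$, $\mathbb{P}_n\to\mathbb{P}$ in the sense of finite-dimensional distributions on $S$ means $\mathbb{E}_{\mathbb{P}_n}[f(X_{t_1},\ldots,X_{t_d})]\to\mathbb{E}_{\mathbb{P}}[f(X_{t_1},\ldots,X_{t_d})]$ for every finite $\{t_1,\ldots,t_d\}\subseteq S$ and every bounded continuous $f:\mathbb{R}^d\to\mathbb{R}$. Convergence in the sense of finite-dimensional distributions \emph{almost everywhere on $\mathbb{R}_+$} means that there is an $S\subseteq\mathbb{R}_+$ such that $\mathbb{R}_+\setminus S$ has zero Lebesgue measure and the convergence holds in the sense of finite-dimensional distributions on $S$. *)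

(* Defs.v *)
From HB Require Import structures.
From mathcomp Require Import all_boot all_order all_algebra.
From mathcomp Require Import all_classical all_reals all_analysis.

Set Implicit Arguments.
Unset Strict Implicit.
Unset Printing Implicit Defensive.

Import Order.TTheory GRing.Theory Num.Theory.
Import numFieldNormedType.Exports.

Local Open Scope classical_set_scope.
Local Open Scope ring_scope.

Lemma maxr0_ge0 (R : realType) (s : R) : 0 <= Num.max 0 s.
Proof. by rewrite le_max lexx. Qed.

(* The library's one-sided limits and variations are about functions R -> R; a
   function on R_+ is extended to the left of 0 by its value at 0, which affects
   neither its right limits at t >= 0, nor its left limits at t > 0, nor its
   variation over [0, t]. *)
Definition extend {R : realType} (f : {nonneg R} -> R) (s : R) : R :=
  f (NngNum (maxr0_ge0 s)).

Definition cadlag {R : realType} (f : {nonneg R} -> R) : Prop :=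
  (forall t : {nonneg R}, extend f s @[s --> t%:num^'+] --> f t) /\
  (forall t : {nonneg R}, 0 < t%:num -> cvg (extend f s @[s --> t%:num^'-])).

Record cadlag_path (R : realType) := CadlagPath {
  path_fun :> {nonneg R} -> R;
  path_cadlag : cadlag path_fun }.

Lemma cadlag_cst (R : realType) (c : R) : cadlag (fun _ : {nonneg R} => c).
Proof. by split=> t *; [exact: cvg_cst | exact: is_cvg_cst]. Qed.

HB.instance Definition _ (R : realType) := gen_eqMixin (cadlag_path R).
HB.instance Definition _ (R : realType) := gen_choiceMixin (cadlag_path R).
HB.instance Definition _ (R : realType) :=
  isPointed.Build (cadlag_path R) (CadlagPath (cadlag_cst (0 : R))).

Definition coordinate {R : realType} (t : {nonneg R}) (w : cadlag_path R) : R := w t.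

Definition coord_events {R : realType} (I : set {nonneg R}) :
    set (set (cadlag_path R)) :=
  \bigcup_(t in I) preimage_set_system setT (coordinate t) (@measurable _ R).

(* (D, F) with F = sigma(X_t : t in R_+). *)
Notation Dspace R :=
  (g_sigma_algebraType (@coord_events R setT)).

(* F_t = sigma(X_s : s in [0, t]). *)
Definition natural_filtration {R : realType} (t : {nonneg R}) :
    set (set (Dspace R)) :=
  <<s coord_events [set s : {nonneg R} | s%:num <= t%:num] >>.

Definition measurable_wrt {R : realType} (G : set (set (Dspace R)))
    (Y : Dspace R -> R) : Prop :=
  forall B : set R, measurable B -> G (Y @^-1` B).

Definition adapted {R : realType} (Y : {nonneg R} -> Dspace R -> R) : Prop :=
  forall t, measurable_wrt (natural_filtration t) (Y t).

Section processes.
Context {R : realType} (P : probability (Dspace R) R).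
Implicit Types Y Z : Dspace R -> R.

(* Z is a version of the conditional expectation E_P[Y | G]. *)
Definition is_cond_expectation (G : set (set (Dspace R))) Y Z : Prop :=
  [/\ measurable_wrt G Z,
      P.-integrable setT (EFin \o Z) &
      forall B, G B ->
        (\int[P]_(w in B) (Z w)%:E = \int[P]_(w in B) (Y w)%:E)%E].

Definition martingale (M : {nonneg R} -> Dspace R -> R) : Prop :=
  [/\ adapted M,
      forall t, P.-integrable setT (EFin \o M t) &
      forall s t : {nonneg R}, s%:num <= t%:num ->
        is_cond_expectation (natural_filtration s) (M t) (M s)].

End processes.

Definition locally_finite_variation {R : realType} (f : {nonneg R} -> R) : Prop :=
  forall t : {nonneg R}, bounded_variation 0 t%:num (extend f).

(* int_0^t |df_s|; the value f 0 itself does not count. *)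
Definition variation_upto {R : realType} (t : {nonneg R}) (f : {nonneg R} -> R) :
    \bar R :=
  total_variation 0 t%:num (extend f).

Definition fdd_cvg_on {R : realType} (S : set {nonneg R})
    (Pn : nat -> probability (Dspace R) R) (P : probability (Dspace R) R) : Prop :=
  forall (d : nat) (t : 'I_d -> {nonneg R}), (forall i, S (t i)) ->
  forall f : 'rV[R]_d -> R, continuous f -> bounded_fun f ->
    'E_(Pn n)[fun w => f (\row_i coordinate (t i) w)]%E @[n --> \oo]
      --> 'E_P[fun w => f (\row_i coordinate (t i) w)]%E.

Definition fdd_cvg_ae {R : realType}
    (Pn : nat -> probability (Dspace R) R) (P : probability (Dspace R) R) : Prop :=
  exists2 S : set {nonneg R},
    lebesgue_measure.-negligible [set t%:num | t in ~` S] & fdd_cvg_on S Pn P.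

(* Main.v *)
(** Discretize: let X exceed the level q at time s be recorded as a bit, for all
    rational s and q. The laws of finitely many bits converge along a
    subsequence, and the limit law of all the bits is realized on [0, 1] by
    nested intervals whose lengths are the limit probabilities.

    By Doob's buy-low sell-high strategy, the number of crossings of [a, b] by a
    process X = M + A along any finite set of times of [0, N] is controlled by
    the mean absolute value of X and the mean variation of A on [0, N]. This
    passes to the limit bits, which therefore almost surely come from a path
    with finite one-sided limits; its right limits form a cadlag process, whose
    law is the limit.

    It remains to compare X at a real time t with X at a rational time s > t,
    uniformly in n. For phi(x) = sqrt(1 + x^2), the quantity
    G_n(t) = E_n[phi(X_t)] + 3 E_n[variation of A^n on [0, t]] is nondecreasing
    in t, and the mean Bregman divergence of phi between X_t and X_s is at most
    G_n(s) - G_n(t). Along the subsequence G_n converges at rational times, so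
    the comparison works at every t > 0 where the limit has no jump, that is
    for all but countably many t. *)
Require Import Defs.
From HB Require Import structures.
From mathcomp Require Import all_boot all_order all_algebra.
From mathcomp Require Import all_classical all_reals all_analysis.
From mathcomp Require Import measurable_realfun.
From mathcomp Require Import zify ring lra.

Set Implicit Arguments.
Unset Strict Implicit.
Unset Printing Implicit Defensive.

Import Order.TTheory GRing.Theory Num.Theory.
Import numFieldNormedType.Exports.

Local Open Scope classical_set_scope.
Local Open Scope ring_scope.

(** * Quasimartingales *)

(** With first moments only, the drift of [A] may concentrate in ever shorter time intervals: the
    laws need not be tight for the usual Skorokhod topology, and convergence may fail at a time
    where the limit energy jumps. A bit has two values, so laws of bits are compact for free. The
    price is that the passage from a value to a bit is discontinuous: a limit bit at time s need not
    describe a limit law of X_s. Limit bits are therefore read only through their germs to the right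
    of a time t. Two limits are interchanged. At a fixed resolution only finitely many bits matter
    and n can tend to infinity; the resolution is refined afterwards, in the limit space. The
    interchange requires an error bound uniform in n, which is the role of the energy. Of the
    decomposition only the inequality in [quasimartingale] survives: increments of X, integrated
    over events of the past, are small. It serves twice, for the gains of a trading strategy and for
    the first-order term of the Bregman divergence. *)

Section lower_integral.
Local Open Scope ereal_scope.
Import HBNNSimple.

(* The functions need not be measurable: the integral of a nonnegative function
   is the supremum of the integrals of the simple functions below it. *)
Lemma le_lower_integral d (T : measurableType d) (R : realType)
    (mu : {measure set T -> \bar R}) (f h : T -> \bar R) :
  (forall x, 0 <= f x) -> (forall x, f x <= h x) ->
  \int[mu]_x f x <= \int[mu]_x h x.
Proof.
move=> f0 fh; rewrite !ge0_integralTE//; last first.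
  by move=> x; exact: le_trans (fh x).
apply: le_ereal_sup => _ [g /= gf <-].
by exists g => //= x; exact: le_trans (fh x).
Qed.

(** The variation of [A], as a function of the path, is not shown to be measurable, so additivity of
    the integral is not at hand for it. Adding the measurable [g] to a simple function below [f]
    keeps additivity, and the supremum over these simple functions gives the direction used
    later. *)
Lemma lower_integral_superadditive d (T : measurableType d) (R : realType)
    (mu : {measure set T -> \bar R}) (f g h : T -> \bar R) :
  (forall x, 0 <= f x) -> (forall x, 0 <= g x) -> measurable_fun setT g ->
  (forall x, f x + g x <= h x) ->
  \int[mu]_x f x + \int[mu]_x g x <= \int[mu]_x h x.
Proof.
move=> f0 g0 mg fgh.
have h0 x : 0 <= h x by apply: le_trans (fgh x); rewrite adde_ge0.
have gh : \int[mu]_x g x <= \int[mu]_x h x.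
  by apply: le_lower_integral => // x; apply: le_trans (fgh x); rewrite leeDr.
have [hoo|] := eqVneq (\int[mu]_x h x) +oo; first by rewrite hoo leey.
rewrite -ltey => hoo.
have gfin : \int[mu]_x g x \is a fin_num.
  by rewrite ge0_fin_numE ?integral_ge0//; exact: le_lt_trans hoo.
rewrite -leeBrDr// [X in X <= _]ge0_integralTE//.
apply: ge_ereal_sup => _ [k /= kf <-]; rewrite leeBrDr//.
rewrite -integralT_nnsfun -ge0_integralD//; last first.
- exact/measurable_EFinP.
- by move=> x _; rewrite lee_fin.
apply: le_lower_integral => x; first by rewrite adde_ge0// lee_fin.
by apply: le_trans (fgh x); rewrite leeD2r.
Qed.

End lower_integral.

Section natural_filtration.
Context {R : realType}.
Implicit Types (s t : {nonneg R}) (B : set (Dspace R)).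

Lemma measurable_coordinate t : measurable_fun setT (coordinate t : Dspace R -> R).
Proof.
move=> _ B mB; apply: sub_sigma_algebra; exists t => //.
by exists B.
Qed.

Lemma natural_filtrationS s t : s%:num <= t%:num ->
  natural_filtration s `<=` natural_filtration t.
Proof.
move=> st; apply: sub_sigma_algebra2 => A [r rs h].
by exists r => //=; exact: le_trans st.
Qed.

Lemma natural_filtration_measurable t B : natural_filtration t B -> measurable B.
Proof. by apply: sub_sigma_algebra2 => A [r rs h]; exists r. Qed.

Lemma coordinate_adapted s t : s%:num <= t%:num ->
  measurable_wrt (natural_filtration t) (coordinate s).
Proof.
move=> st B mB; apply: sub_sigma_algebra; exists s => //.
by exists B => //; rewrite setTI.
Qed.

Lemma adapted_measurable (Y : {nonneg R} -> Dspace R -> R) t :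
  adapted Y -> measurable_fun setT (Y t).
Proof.
move=> Yad _ B mB; rewrite setTI.
exact: natural_filtration_measurable (Yad t B mB).
Qed.

Lemma extend_num (f : {nonneg R} -> R) t : extend f t%:num = f t.
Proof. by rewrite /extend; congr f; apply/val_inj => /=; exact/max_idPr. Qed.

End natural_filtration.

(** A variant of Rao's quasimartingales. Testing increments on events of the past avoids conditional
    expectations, and the deterministic [V] bounds the drift additively, so that estimates over
    successive intervals telescope. *)
Definition quasimartingale (R : realType) (P : probability (Dspace R) R)
    (V : {nonneg R} -> R) : Prop :=
  [/\ forall t, P.-integrable setT (EFin \o (coordinate t : Dspace R -> R)),
      forall t, 0 <= V t &
      forall (s t : {nonneg R}) B, s%:num <= t%:num -> natural_filtration s B ->
        `|\int[P]_(w in B) (coordinate t w - coordinate s w)| <= V t - V s].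

(** On an event of F_s the martingale increment has integral zero, so only [A t - A s] is left. Its
    absolute value is at most the variation on [s, t], the difference of the variations on [0, t]
    and [0, s]. *)
Lemma decomposition_quasimartingale (R : realType) (P : probability (Dspace R) R)
    (M A : {nonneg R} -> Dspace R -> R) :
  martingale P M -> adapted A ->
  {ae P, forall w t, coordinate t w = M t w + A t w} ->
  (forall t, 'E_P[fun w => (`|coordinate t w|)%R] +
     \int[P]_w variation_upto t (fun s => A s w) < +oo)%E ->
  quasimartingale P
    (fun t => fine (\int[P]_w variation_upto t (fun s => A s w))).
Proof.
move=> [Mad Mint Mce] Aad XMA moments.
have Fae : Filter (nbhs (almost_everywhere P)) := ae_filter_ringOfSetsType P.
have TV0 t w : (0 <= variation_upto t (fun s => A s w))%E.
  exact: total_variation_ge0.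
have iTV0 t : (0 <= \int[P]_w variation_upto t (fun s => A s w))%E.
  exact: integral_ge0.
have iX0 t : (0 <= 'E_P[fun w => (`|coordinate t w|)%R])%E.
  by rewrite expectation_ge0.
have iTVfin t : (\int[P]_w variation_upto t (fun s => A s w))%E \is a fin_num.
  by rewrite ge0_fin_numE//; apply: le_lt_trans (moments t); rewrite leeDr.
have mX t := @measurable_coordinate R t.
have iX t : P.-integrable setT (EFin \o (coordinate t : Dspace R -> R)).
  apply/integrableP; split; first by apply/measurable_EFinP; exact: mX.
  apply: le_lt_trans (moments t); rewrite unlock.
  exact: leeDl.
have mA t := adapted_measurable t Aad.
have mM t := adapted_measurable t Mad.
have iA t : P.-integrable setT (EFin \o A t).
  have /integrableP[mXM XMoo] : P.-integrable setT
      (EFin \o (fun w => coordinate t w - M t w)).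
    exact: (integrableB measurableT (iX t) (Mint t)).
  apply/integrableP; split; first exact/measurable_EFinP.
  apply: le_lt_trans XMoo; rewrite le_eqVlt; apply/orP; left; apply/eqP.
  apply: ae_eq_integral => //.
  - by apply: measurableT_comp => //; exact/measurable_EFinP.
  - exact: measurableT_comp.
  - by apply: filterS XMA => w wE _; rewrite /= wE addrAC subrr add0r.
have iAB s t : P.-integrable setT (EFin \o (fun w => A t w - A s w)).
  exact: (integrableB measurableT (iA t) (iA s)).
have iMB s t : P.-integrable setT (EFin \o (fun w => M t w - M s w)).
  exact: (integrableB measurableT (Mint t) (Mint s)).
have iNAB s t : P.-integrable setT (EFin \o (fun w => `|A t w - A s w|)).
  exact: (integrable_norm (iAB s t)).
split=> // [t|s t B st FB]; first exact: fine_ge0.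
have mB := natural_filtration_measurable FB.
have iB f : P.-integrable setT (EFin \o f) -> P.-integrable B (EFin \o f).
  by move=> h; exact: integrableS h.
have -> : \int[P]_(w in B) (coordinate t w - coordinate s w) =
    \int[P]_(w in B) (A t w - A s w).
  transitivity (\int[P]_(w in B) ((M t w - M s w) + (A t w - A s w))).
    congr fine; apply: ae_eq_integral => //=.
    + apply/measurable_EFinP/measurable_funB.
        exact: measurable_funTS (measurable_coordinate _).
      exact: measurable_funTS (measurable_coordinate _).
    + by apply/measurable_EFinP/measurable_funTS/measurable_funD;
         apply: measurable_funB.
    + apply: filterS XMA => w h _; rewrite !h; congr EFin.
      by rewrite opprD addrACA.
  rewrite RintegralD//; last 2 first.
  - exact: (iB (fun w => M t w - M s w)).
  - exact: (iB (fun w => A t w - A s w)).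
  rewrite RintegralB//; last 2 first.
  - exact: (iB (M t)).
  - exact: (iB (M s)).
  by rewrite /Rintegral; have [_ _ ->] := Mce _ _ st; rewrite // subrr add0r.
apply: (@le_trans _ _ (\int[P]_w `|A t w - A s w|)).
  apply: le_trans (le_normr_Rintegral _ _) _ => //.
    exact: (iB (fun w => A t w - A s w)).
  rewrite /Rintegral fine_le//.
  - by apply: integrable_fin_num => //; exact: (iB (fun w => `|A t w - A s w|)).
  - exact: (integrable_fin_num measurableT (iNAB s t)).
  - apply: ge0_subset_integral => //.
    by apply/measurable_EFinP/measurableT_comp => //; apply: measurable_funB.
rewrite lerBrDl -lee_fin EFinD !fineK//; last first.
  exact: (integrable_fin_num measurableT (iNAB s t)).
apply: lower_integral_superadditive => //.
- by apply/measurable_EFinP/measurableT_comp => //; apply: measurable_funB.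
- move=> w; rewrite {2}/variation_upto (total_variationD _ _ st)//.
  by rewrite leeD2l// -(extend_num (A^~ w)) -(extend_num (A^~ w) s) total_variation_ge.
Qed.

Lemma measurable_superlevel d (T : measurableType d) (R : realType)
    (f : T -> R) (a : R) :
  measurable_fun setT f -> measurable [set x | a < f x].
Proof.
move=> mf; rewrite (_ : [set x | _] = setT `&` f @^-1` `]a, +oo[%classic).
  exact: mf.
by rewrite setTI; apply/seteqP; split=> x /=; rewrite in_itv/= andbT.
Qed.

Section real_integrals.
Context d (T : measurableType d) (R : realType) (P : probability T R).
Implicit Types f g h : T -> R.

Lemma integrable_bounded_mul h f (C : R) : measurable_fun setT h ->
  (forall x, `|h x| <= C) -> P.-integrable setT (EFin \o f) ->
  P.-integrable setT (EFin \o (fun x => h x * f x)).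
Proof.
move=> mh hC fi; apply: (@integrableMr _ _ _ _ _ _ h (EFin \o f)) => //.
exists C; split; first exact: num_real.
by move=> M CM x _; apply: le_trans (hC x) (ltW CM).
Qed.

Lemma integrable_bounded h (C : R) : measurable_fun setT h ->
  (forall x, `|h x| <= C) -> P.-integrable setT (EFin \o h).
Proof.
move=> mh hC; apply: measurable_bounded_integrable => //.
  exact: (le_lt_trans (probability_le1 P measurableT) (ltry 1)).
exists C; split; first exact: num_real.
by move=> M CM x _; apply: le_trans (hC x) (ltW CM).
Qed.

Lemma Rintegral_probability_cst (c : R) : \int[P]_x c = c.
Proof.
rewrite Rintegral_cst//; set p := (X in fine X).
by rewrite (_ : p = 1%E) ?mulr1//; exact: probability_setT.
Qed.

Lemma integrable_indic_mul (B : set T) f : measurable B ->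
  P.-integrable setT (EFin \o f) ->
  P.-integrable setT (EFin \o (fun x => \1_B x * f x)).
Proof.
move=> mB; apply: (@integrable_bounded_mul _ _ 1) => // x.
by rewrite indicE; case: (x \in B); rewrite ?normr1 ?normr0.
Qed.

Lemma integrable_real_sum (I : Type) (s : seq I) (f : I -> T -> R) :
  (forall i, P.-integrable setT (EFin \o f i)) ->
  P.-integrable setT (EFin \o (fun x => \sum_(i <- s) f i x)).
Proof.
move=> fi; rewrite (_ : _ \o _ = fun x => (\sum_(i <- s) (f i x)%:E)%E).
  exact: (@integrable_sum _ _ _ _ _ _ _ _ _ (fun i => EFin \o f i)).
by apply/funext => x /=; rewrite sumEFin.
Qed.

Lemma Rintegral_sum (I : Type) (s : seq I) (f : I -> T -> R) :
  (forall i, P.-integrable setT (EFin \o f i)) ->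
  \int[P]_x (\sum_(i <- s) f i x) = \sum_(i <- s) \int[P]_x f i x.
Proof.
move=> fi; elim: s => [|i s IH].
  rewrite big_nil (@eq_Rintegral _ _ _ _ _ (cst 0)); last first.
    by move=> x _; rewrite big_nil.
  by rewrite Rintegral_cst ?mul0r.
rewrite big_cons -IH -RintegralD//; last exact: integrable_real_sum.
by apply: eq_Rintegral => x _; rewrite big_cons.
Qed.

Lemma Rintegral_indic_mul (B : set T) f :
  \int[P]_x (\1_B x * f x) = \int[P]_(x in B) f x.
Proof.
rewrite [RHS]Rintegral_mkcond; apply: eq_Rintegral => x _.
rewrite patchE indicE; case: ifPn; rewrite ?mul1r ?mul0r//.
Qed.

Lemma Rintegral_le_norm f : P.-integrable setT (EFin \o f) ->
  `|\int[P]_x f x| <= \int[P]_x `|f x|.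
Proof. exact: le_normr_Rintegral. Qed.

End real_integrals.

Lemma sum_lt_bounds (R : realType) (y : R) (m : nat) : 0 <= y <= m%:R ->
  y <= \sum_(0 <= j < m) (j%:R < y)%R%:R <= y + 1.
Proof.
move=> /andP[y0 ym].
(* The sum is [y] rounded up. Truncating at [m] lets the induction run without [y <= m]. *)
have : Num.min m%:R y <= \sum_(0 <= j < m) (j%:R < y)%R%:R <= Num.min m%:R (y + 1).
  elim: m {ym} => [|m /andP[IH1 IH2]].
    by rewrite big_geq//; rewrite !min_l ?lexx// addr_ge0.
  rewrite big_nat_recr//=.
  have [my|ym] := ltP m%:R y.
    rewrite (min_l (ltW my)) in IH1; rewrite min_l in IH2; last first.
      by rewrite ltW// (lt_trans my)// ltrDl.
    rewrite -natr1 ge_min lerD2r IH1/= le_min lerD2r IH2/=.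
    by rewrite lerD2r (le_trans IH2)// ltW.
  rewrite addr0 !(ge_min, le_min); move: IH1 IH2.
  rewrite min_r// le_min => -> /andP[h ->]; rewrite orbT/= andbT (le_trans h)//.
  by rewrite ler_nat.
rewrite min_r// => /andP[-> /= h]; apply: le_trans h _.
by rewrite ge_min lexx orbT.
Qed.

(* H is a mixture of the indicators of its superlevel sets. *)
Lemma Rintegral_mul_bound d (T : measurableType d) (R : realType)
    (P : probability T R) (H xi : T -> R) (c : R) :
  measurable_fun setT H -> (forall x, 0 <= H x <= 1) ->
  P.-integrable setT (EFin \o xi) ->
  (forall a : R, `|\int[P]_(x in [set x | a < H x]) xi x| <= c) ->
  `|\int[P]_x (H x * xi x)| <= c.
Proof.
move=> mH H01 ixi Hc.
pose B m j := [set x | j%:R / m.+1%:R < H x].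
(* Rounds [H x] up to a multiple of 1 / (m + 1). It is an average of m + 1 indicators, for each of
   which the bound [c] is known. *)
pose Hm (m : nat) x : R := m.+1%:R^-1 * \sum_(0 <= j < m.+1) \1_(B m j) x.
have mB m j : measurable (B m j).
  exact: measurable_superlevel.
have HmE m x : H x <= Hm m x <= H x + m.+1%:R^-1.
  have /andP[H0 H1] := H01 x.
  have /sum_lt_bounds : 0 <= m.+1%:R * H x <= m.+1%:R.
    by rewrite mulr_ge0//= ler_piMr.
  have -> : \sum_(0 <= j < m.+1) (j%:R < m.+1%:R * H x)%R%:R =
      \sum_(0 <= j < m.+1) \1_(B m j) x :> R.
    apply: eq_bigr => j _; rewrite indicE; congr (nat_of_bool _)%:R.
    apply/idP/idP => [jH|/set_mem]; first apply/mem_set; rewrite /B/=.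
      by rewrite ltr_pdivrMr// mulrC.
    by rewrite ltr_pdivrMr// mulrC.
  rewrite /Hm => /andP[h1 h2]; apply/andP; split.
    by rewrite mulrC ler_pdivlMr// mulrC.
  by rewrite mulrC ler_pdivrMr// mulrDl mulVf// mulrC.
have iind m j : P.-integrable setT (EFin \o (fun x => \1_(B m j) x * xi x)).
  exact: integrable_indic_mul.
have iHmxi m : P.-integrable setT (EFin \o (fun x => Hm m x * xi x)).
  apply: (@integrable_bounded_mul _ _ _ _ _ _ 2) => //.
    apply: measurable_funM => //; apply: measurable_sum => j.
    exact: measurable_indic.
  move=> x; have /andP[h1 h2] := HmE m x; have /andP[H0 H1] := H01 x.
  rewrite ger0_norm ?(le_trans H0)// (le_trans h2)// -[2]/(1 + 1).
  by rewrite lerD// invf_le1// ler1n.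
have iHxi : P.-integrable setT (EFin \o (fun x => H x * xi x)).
  apply: (@integrable_bounded_mul _ _ _ _ _ _ 1) => // x.
  by have /andP[H0 H1] := H01 x; rewrite ger0_norm.
have Hmc m : `|\int[P]_x (Hm m x * xi x)| <= c.
  have -> : \int[P]_x (Hm m x * xi x) =
      m.+1%:R^-1 * \sum_(0 <= j < m.+1) \int[P]_(x in B m j) xi x.
    rewrite (@eq_Rintegral _ _ _ _ _ (fun x => m.+1%:R^-1 *
        \sum_(0 <= j < m.+1) (\1_(B m j) x * xi x))); last first.
      by move=> x _; rewrite /Hm -mulrA mulr_suml.
    rewrite RintegralZl//; last exact: integrable_real_sum.
    rewrite Rintegral_sum//; congr (_ * _).
    by apply: eq_bigr => j _; rewrite Rintegral_indic_mul.
  rewrite normrM ger0_norm// mulrC ler_pdivrMr//.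
  apply: le_trans (ler_norm_sum _ _ _) _.
  apply: le_trans (ler_sum _ (fun j _ => Hc (j%:R / m.+1%:R))) _.
  by rewrite big_const_nat iter_addr addr0 subn0 mulr_natr.
apply/ler_addgt0Pr => e e0.
pose D := \int[P]_x `|xi x|.
have D0 : 0 <= D by exact: Rintegral_ge0.
have [m Dm] : exists m : nat, D / e <= m.+1%:R.
  exists (Num.trunc (D / e)); apply/ltW/truncnS_gt.
have -> : \int[P]_x (H x * xi x) = \int[P]_x (Hm m x * xi x) -
    \int[P]_x ((Hm m x - H x) * xi x).
  rewrite [X in _ - X](@eq_Rintegral _ _ _ _ _
      (fun x => Hm m x * xi x - H x * xi x)); last by move=> x _; rewrite mulrBl.
  by rewrite RintegralB// opprB addrC subrK.
apply: le_trans (ler_normB _ _) _; apply: lerD => //.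
have iD : P.-integrable setT (EFin \o (fun x => (Hm m x - H x) * xi x)).
  rewrite (_ : (fun x => _) = (fun x => Hm m x * xi x - H x * xi x)).
    exact: (integrableB measurableT (iHmxi m) iHxi).
  by apply/funext => x; rewrite mulrBl.
apply: le_trans (Rintegral_le_norm iD) _.
apply: (@le_trans _ _ (\int[P]_x (m.+1%:R^-1 * `|xi x|))).
  apply: le_Rintegral => //.
  - exact: (integrable_norm iD).
  - apply: (@integrable_bounded_mul _ _ _ _ (cst m.+1%:R^-1) _ m.+1%:R^-1) => //.
      by move=> x /=; rewrite ger0_norm.
    exact: (integrable_norm ixi).
  - move=> x _; rewrite normrM ler_wpM2r//.
    have /andP[h1 h2] := HmE m x.
    by rewrite ger0_norm ?subr_ge0// lerBlDl.
rewrite RintegralZl//; last exact: (integrable_norm ixi).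
by rewrite mulrC ler_pdivrMr// mulrC -ler_pdivrMr.
Qed.

(** * Energy of a quasimartingale *)

Section bregman.
Context {R : realType}.
Implicit Types x y : R.

(** Linear growth makes it integrable under a first moment; a derivative bounded by 1 can be tested
    against the drift; strict convexity lets the Bregman divergence separate points of bounded sets.
    The square fails the first two, the absolute value the third. *)
Definition jbracket x : R := Num.sqrt (1 + x ^+ 2).

(* The Bregman divergence of the strictly convex function [jbracket], whose
   derivative is [x / jbracket x]. *)
Definition bregman x y : R :=
  jbracket y - jbracket x - x / jbracket x * (y - x).

Lemma sqr_jbracket x : jbracket x ^+ 2 = 1 + x ^+ 2.
Proof. by rewrite sqr_sqrtr// addr_ge0// sqr_ge0. Qed.

Lemma jbracket_ge1 x : 1 <= jbracket x.
Proof.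
by rewrite -[leLHS]sqrtr1 ler_wsqrtr// lerDl sqr_ge0.
Qed.

Lemma jbracket_gt0 x : 0 < jbracket x.
Proof. exact: lt_le_trans (jbracket_ge1 x). Qed.

Lemma norm_le_jbracket x : `|x| <= jbracket x.
Proof. by rewrite -sqrtr_sqr ler_wsqrtr// lerDr. Qed.

Lemma jbracket_le x : jbracket x <= 1 + `|x|.
Proof.
rewrite -[leRHS]ger0_norm ?addr_ge0// -sqrtr_sqr ler_wsqrtr//.
rewrite sqrrD expr1n mul1r -normrX [`|x ^+ 2|]ger0_norm ?sqr_ge0//.
by rewrite addrAC lerDl mulrn_wge0.
Qed.

Lemma norm_jbracket_derivative x : `|x / jbracket x| <= 1.
Proof.
rewrite normrM normfV [`|jbracket x|]gtr0_norm ?jbracket_gt0//.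
by rewrite ler_pdivrMr ?jbracket_gt0// mul1r norm_le_jbracket.
Qed.

Lemma bregmanE x y :
  bregman x y = (jbracket x * jbracket y - (1 + x * y)) / jbracket x.
Proof.
have p0 := lt0r_neq0 (jbracket_gt0 x); apply: (mulIf p0).
rewrite divfK// /bregman !mulrBl mulrAC divfK// -expr2 sqr_jbracket.
by rewrite mulrBr -[x * x]expr2; ring.
Qed.

(** With p the product of the two brackets and q = 1 + xy, Lagrange's identity reads p^2 = q^2 + (x
    - y)^2. Hence (x - y)^2 = (p - q)(p + q) <= (p - q) 2p, and p - q is [bregman x y * jbracket x]
    by [bregmanE]. *)
Lemma bregman_bound x y :
  (x - y) ^+ 2 <= bregman x y * (2 * jbracket x ^+ 2 * jbracket y).
Proof.
have px := jbracket_gt0 x; have py := jbracket_gt0 y.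
have key : (jbracket x * jbracket y) ^+ 2 = (1 + x * y) ^+ 2 + (x - y) ^+ 2.
  by rewrite exprMn !sqr_jbracket; ring.
set p := jbracket x * jbracket y in key *.
have p0 : 0 < p by rewrite mulr_gt0.
have le1 : `|1 + x * y| <= p.
  rewrite -(ger0_norm (ltW p0)) -ler_sqr ?nnegrE// !real_normK ?num_real//.
  by rewrite key lerDl sqr_ge0.
have -> : bregman x y * (2 * jbracket x ^+ 2 * jbracket y) =
    (p - (1 + x * y)) * (2 * p).
  by rewrite bregmanE -/p /p; field; exact: lt0r_neq0.
have -> : (x - y) ^+ 2 = (p - (1 + x * y)) * (p + (1 + x * y)).
  by rewrite -subr_sqr key addrAC subrr add0r.
move: le1; rewrite ler_norml => /andP[h1 h2].
by apply: ler_wpM2l; lra.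
Qed.

Lemma bregman_ge0 x y : 0 <= bregman x y.
Proof.
have h := le_trans (sqr_ge0 _) (bregman_bound x y).
rewrite -(pmulr_lge0 _ (_ : 0 < 2 * jbracket x ^+ 2 * jbracket y))//.
by rewrite !mulr_gt0// ?exprn_gt0// jbracket_gt0.
Qed.

Lemma continuous_jbracket : continuous (jbracket : R -> R).
Proof.
move=> x; apply: (@continuous_comp _ _ _ (fun x : R => 1 + x ^+ 2) Num.sqrt).
  by apply: cvgD; [exact: cvg_cst|exact: exprn_continuous].
exact: sqrt_continuous.
Qed.

Lemma measurable_jbracket : measurable_fun setT (jbracket : R -> R).
Proof.
by apply: continuous_measurable_fun; exact: continuous_jbracket.
Qed.

Lemma measurable_jbracket_derivative :
  measurable_fun setT (fun x : R => x / jbracket x).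
Proof.
apply: continuous_measurable_fun => x.
apply: cvgM; first exact: cvg_id.
apply: cvgV; first by rewrite lt0r_neq0// jbracket_gt0.
exact: continuous_jbracket.
Qed.

End bregman.

(* V t bounds the drift of the coordinate process tested against indicators; for
   test functions with values in [-1, 1] the bound becomes 3 V t. *)
Definition energy (R : realType) (P : probability (Dspace R) R)
    (V : {nonneg R} -> R) (t : {nonneg R}) : R :=
  \int[P]_w jbracket (coordinate t w) + 3 * V t.

Section energy.
Context {R : realType} (P : probability (Dspace R) R) (V : {nonneg R} -> R).
Hypothesis qP : quasimartingale P V.
Let X (t : {nonneg R}) : Dspace R -> R := coordinate t.

Let mX t : measurable_fun setT (X t) := @measurable_coordinate R t.

Let iX t : P.-integrable setT (EFin \o X t). Proof. by case: qP. Qed.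

Let V0 t : 0 <= V t. Proof. by case: qP. Qed.

Let mJX t : measurable_fun setT (fun w => jbracket (X t w)).
Proof. exact: measurableT_comp measurable_jbracket (mX t). Qed.

Lemma integrable_jbracket t :
  P.-integrable setT (EFin \o (fun w => jbracket (X t w))).
Proof.
have i1 : P.-integrable setT (EFin \o (fun w => 1 + `|X t w|)).
  have ic : P.-integrable setT (EFin \o cst 1).
    by apply: (@integrable_bounded _ _ _ _ (cst 1) 1) => // x; rewrite normr1.
  exact: (integrableD measurableT ic (integrable_norm (iX t))).
apply: le_integrable i1 => //; first by apply/measurable_EFinP; exact: mJX.
move=> w _ /=; rewrite lee_fin ger0_norm ?(ltW (jbracket_gt0 _))//.
by rewrite (le_trans (jbracket_le _))// ler_norm.
Qed.

Let mD s : measurable_fun setT (fun w => X s w / jbracket (X s w)).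
Proof. exact: measurableT_comp measurable_jbracket_derivative (mX s). Qed.

Lemma integrable_bregman s t :
  P.-integrable setT (EFin \o (fun w => bregman (X s w) (X t w))).
Proof.
have iD : P.-integrable setT
    (EFin \o fun w => X s w / jbracket (X s w) * (X t w - X s w)).
  apply: (@integrable_bounded_mul _ _ _ _ _ _ 1) => //.
  - by move=> w; exact: norm_jbracket_derivative.
  - exact: (integrableB measurableT (iX t) (iX s)).
have iJ := integrable_jbracket.
exact: (integrableB measurableT (integrableB measurableT (iJ t) (iJ s)) iD).
Qed.

(** The first-order term of the divergence multiplies the increment by a function of X_s bounded by
    1, so its mean is at most three increments of [V]; the remaining terms are the increment of the
    mean of [jbracket]. *)
Lemma Rintegral_bregman_le (s t : {nonneg R}) : s%:num <= t%:num ->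
  \int[P]_w bregman (X s w) (X t w) <= energy P V t - energy P V s.
Proof.
move=> st; have [_ _ qV] := qP.
pose xi w := X t w - X s w; pose D w := X s w / jbracket (X s w).
(* Rescales [D] from [-1, 1] to [0, 1]. Undoing this by D = 2 H - 1 costs 2 + 1 times the bound,
   hence the factor 3 in [energy]. *)
pose H w := (1 + D w) / 2.
have ixi : P.-integrable setT (EFin \o xi).
  exact: (integrableB measurableT (iX t) (iX s)).
have mH : measurable_fun setT H.
  by apply: measurable_funM => //; apply: measurable_funD => //; exact: mD.
have H01 w : 0 <= H w <= 1.
  by have := norm_jbracket_derivative (X s w); rewrite ler_norml /H /D; lra.
have iD : P.-integrable setT (EFin \o (fun w => D w * xi w)).
  apply: (@integrable_bounded_mul _ _ _ _ _ _ 1) => //; first exact: mD.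
  by move=> w; exact: norm_jbracket_derivative.
have iHxi : P.-integrable setT (EFin \o (fun w => H w * xi w)).
  apply: (@integrable_bounded_mul _ _ _ _ _ _ 1) => // w.
  by have := H01 w => /andP[h0 h1]; rewrite ger0_norm.
have Hc : `|\int[P]_w (H w * xi w)| <= V t - V s.
  apply: Rintegral_mul_bound => // a; apply: qV => //.
  have mB : measurable [set x : R | a < (1 + x / jbracket x) / 2].
    apply: measurable_superlevel; apply: measurable_funM => //.
    by apply: measurable_funD => //; exact: measurable_jbracket_derivative.
  exact: (coordinate_adapted (lexx s%:num) mB).
have xic : `|\int[P]_w xi w| <= V t - V s.
  by apply: qV => //; have := coordinate_adapted (lexx s%:num) measurableT.
have DE : \int[P]_w (D w * xi w) = 2 * \int[P]_w (H w * xi w) - \int[P]_w xi w.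
  rewrite -RintegralZl// -RintegralB//; last first.
    by apply: (@integrable_bounded_mul _ _ _ _ (cst 2) _ 2) => // x /=;
       rewrite ger0_norm.
  by apply: eq_Rintegral => w _; rewrite /H; field.
have BE : \int[P]_w bregman (X s w) (X t w) =
    \int[P]_w jbracket (X t w) - \int[P]_w jbracket (X s w) -
    \int[P]_w (D w * xi w).
  have iJ := integrable_jbracket.
  rewrite -RintegralB// -RintegralB//.
  exact: (integrableB measurableT (iJ t) (iJ s)).
move: Hc xic; rewrite !ler_norml => /andP[h1 h2] /andP[h3 h4].
by rewrite BE DE /energy; lra.
Qed.

Lemma energy_nondecreasing (s t : {nonneg R}) : s%:num <= t%:num ->
  energy P V s <= energy P V t.
Proof.
move=> st; rewrite -subr_ge0; apply: le_trans (Rintegral_bregman_le st).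
by apply: Rintegral_ge0 => w _; exact: bregman_ge0.
Qed.

Lemma Rintegral_jbracket_le_energy t :
  \int[P]_w jbracket (X t w) <= energy P V t.
Proof. by rewrite /energy lerDl mulr_ge0. Qed.

Lemma Rintegral_norm_le_energy t : \int[P]_w `|X t w| <= energy P V t.
Proof.
apply: le_trans (Rintegral_jbracket_le_energy t); apply: le_Rintegral => //.
- exact: (integrable_norm (iX t)).
- exact: integrable_jbracket.
- by move=> w _; exact: norm_le_jbracket.
Qed.

Lemma energy_le t : energy P V t <= 1 + \int[P]_w `|X t w| + 3 * V t.
Proof.
rewrite lerD2r.
have i1 : P.-integrable setT (EFin \o cst 1).
  by apply: (@integrable_bounded _ _ _ _ (cst 1) 1) => // x; rewrite normr1.
have iN := integrable_norm (iX t).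
have -> : 1 + \int[P]_w `|X t w| = \int[P]_w (1 + `|X t w|).
  rewrite RintegralD//; congr +%R.
  by rewrite Rintegral_probability_cst.
apply: le_Rintegral => //.
- exact: integrable_jbracket.
- exact: (integrableD measurableT i1 iN).
- by move=> w _; exact: jbracket_le.
Qed.

End energy.

(** * Crossings *)

(* Counter of the greedy buy-low sell-high strategy: an even value means that no
   unit is held, the next event being a price with first bit false (below the
   lower level); an odd value means that a unit is held, the next event being a
   price with second bit true (above the upper level). *)
Definition phase_step (v : nat) (c : bool * bool) : nat :=
  v + (if odd v then c.2 else ~~ c.1).

Definition phase : nat -> seq (bool * bool) -> nat := foldl phase_step.

Lemma leq_phase_step v c : (v <= phase_step v c)%N.
Proof. by rewrite /phase_step leq_addr. Qed.

Lemma phase_step_mono c : {homo phase_step^~ c : v v' / (v <= v')%N}.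
Proof.
move=> v v'; rewrite leq_eqVlt => /predU1P[-> //|vv'].
apply: leq_trans (leq_phase_step v' c); apply: leq_trans vv'.
by rewrite /phase_step; case: ifP => _; [case: c.2|case: (~~ c.1)]; rewrite ?addn0 ?addn1.
Qed.

(** Watching more prices never slows down the greedy strategy. Crossing events therefore increase
    along refining sets of times, and continuity from below applies to them. *)
Lemma phase_subseq s s' v v' : (v <= v')%N -> subseq s s' ->
  (phase v s <= phase v' s')%N.
Proof.
elim: s' s v v' => [|c' s' IH] [|c s] v v' vv'//=.
- by move=> _; apply: (IH [::]) (sub0seq _); exact: leq_trans (leq_phase_step _ _).
- case: eqVneq => [->|_] h.
    by apply: IH => //; exact: phase_step_mono.
  by apply: (IH (c :: s)) => //; exact: leq_trans (leq_phase_step _ _).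
Qed.

Section wealth.
Context {R : realType} (a b : R).

Definition level_bits (x : R) : bool * bool := (a < x, b < x).

(** The gain of the strategy, a discrete stochastic integral. [v] is the phase after the price [x]
    has been seen, so whether a unit is held during the move from [x] to [y] is decided before [y]
    is known. *)
Fixpoint wealth (v : nat) (x : R) (xs : seq R) : R :=
  if xs is y :: ys
  then (odd v)%:R * (y - x) + wealth (phase_step v (level_bits y)) y ys
  else 0.

(** Round trips valued at [b - a], plus the held unit valued relative to [a], form a potential that
    never grows by more than the gain of a step: a purchase at [y <= a] adds [y - a <= 0], a sale at
    [y > b] turns [y - a] into the smaller [b - a]. *)
Lemma wealth_ge v x xs :
  let v' := phase v (map level_bits xs) in
  (b - a) * v'./2%:R + (odd v')%:R * (last x xs - a) <=
  wealth v x xs + (b - a) * v./2%:R + (odd v)%:R * (x - a).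
Proof.
elim: xs v x => [|y ys IH] v x /=; first by rewrite add0r.
apply: le_trans (IH _ _) _; set w := wealth _ _ _.
set v' := phase_step _ _.
suff : (b - a) * v'./2%:R + (odd v')%:R * (y - a) <=
    (b - a) * v./2%:R + (odd v)%:R * (y - a) by lra.
rewrite {w IH}/v'.
rewrite /phase_step /level_bits /=.
have [ov|ev] := boolP (odd v).
  have [by_|yb] := ltP b y; last by rewrite addn0 ov; lra.
  have -> : (v + true)./2 = v./2.+1 by lia.
  by rewrite addn1 /= ov -natr1 /=; lra.
have [ay|ya] := ltP a y; first by rewrite addn0 (negbTE ev); lra.
have -> : (v + true)./2 = v./2 by lia.
by move: ev; rewrite addn1 /= => -> ; case: (odd v) => //=; lra.
Qed.

End wealth.

(** Measurability for all subsets of [D]. It holds for whatever is computed from finitely many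
    measurable bits, and spares the choice of a sigma-algebra on words or phases. *)
Definition discrete_measurable d (T : measurableType d) (D : Type) (f : T -> D) :=
  forall Q : set D, measurable (f @^-1` Q).

Lemma discrete_measurable_cst d (T : measurableType d) (D : Type) (c : D) :
  discrete_measurable (fun _ : T => c).
Proof.
move=> Q; have [h|h] := pselect (Q c).
  by rewrite (_ : _ @^-1` Q = setT)//; apply/seteqP; split.
by rewrite (_ : _ @^-1` Q = set0)//; apply/seteqP; split.
Qed.

Lemma discrete_measurable_bind d (T : measurableType d) (D D' : Type)
    (f : T -> D) (B : T -> bool) (g : D -> bool -> D') :
  discrete_measurable f -> measurable [set x | B x] ->
  discrete_measurable (fun x => g (f x) (B x)).
Proof.
move=> mf mB Q; rewrite (_ : _ @^-1` Q =
  ([set x | B x] `&` (f @^-1` [set y | Q (g y true)])) `|`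
  (~` [set x | B x] `&` (f @^-1` [set y | Q (g y false)]))).
  by apply: measurableU; apply: measurableI => //; exact: measurableC.
apply/seteqP; split=> x /=.
  case: (B x) => h; first by left.
  by right.
by case: (B x) => -[[]|[]].
Qed.

Lemma discrete_measurable_seq d (T : measurableType d) (J : Type)
    (B : J -> T -> bool) (s : seq J) :
  (forall j, measurable [set x | B j x]) ->
  discrete_measurable (fun x => [seq B j x | j <- s]).
Proof.
move=> mB; elim: s => [|j s IH]; first exact: discrete_measurable_cst.
exact: (discrete_measurable_bind (fun l c => c :: l)).
Qed.

Lemma le_probability_Rintegral d (T : measurableType d) (R : realType)
    (P : probability T R) (E : set T) (f : T -> R) (c : R) : measurable E ->
  P.-integrable setT (EFin \o f) -> (forall x, c * \1_E x <= f x) ->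
  c * fine (P E) <= \int[P]_x f x.
Proof.
move=> mE fi cf.
have iE : P.-integrable setT (EFin \o \1_E) by exact: integrable_indic.
have -> : c * fine (P E) = \int[P]_x (c * \1_E x).
  rewrite RintegralZl//; congr (_ * fine _).
  by rewrite integral_indic// setIT.
apply: le_Rintegral => //.
by apply: (@integrable_bounded_mul _ _ _ _ (cst c) _ `|c|).
Qed.

Section crossings.
Context {R : realType} (P : probability (Dspace R) R) (V : {nonneg R} -> R).
Hypothesis qP : quasimartingale P V.
Let X (t : {nonneg R}) : Dspace R -> R := coordinate t.

Let iX t : P.-integrable setT (EFin \o X t). Proof. by case: qP. Qed.

Let V0 t : 0 <= V t. Proof. by case: qP. Qed.

(** The path space with the sigma-algebra F_t, so that [discrete_measurable (v : Ft t -> nat)] says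
    that [v] is known at time t. *)
Let Ft (t : {nonneg R}) := g_sigma_algebraType
  (@coord_events R [set s : {nonneg R} | s%:num <= t%:num]).

Let path_times := path (fun s t : {nonneg R} => s%:num <= t%:num).

Lemma discrete_measurable_phase_step a b s t (v : Dspace R -> nat) :
  s%:num <= t%:num -> discrete_measurable (v : Ft s -> nat) ->
  discrete_measurable
    ((fun w => phase_step (v w) (level_bits a b (X t w))) : Ft t -> nat).
Proof.
move=> st mv.
have mX c : measurable ([set w | c < X t w] : set (Ft t)).
  rewrite (_ : [set w | _] = X t @^-1` [set` `]c, +oo[ ]).
    exact: (coordinate_adapted (lexx t%:num) (measurable_itv _)).
  by apply/seteqP; split=> w /=; rewrite in_itv/= andbT.
have mv' : discrete_measurable (v : Ft t -> nat).
  by move=> Q; apply: (natural_filtrationS st); exact: mv.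
have h1 := discrete_measurable_bind (fun n c => (n, c)) mv' (mX a).
exact: (discrete_measurable_bind (fun n c => phase_step n.1 (n.2, c)) h1 (mX b)).
Qed.

(** A unit is held on an event of F_t, so the mean gain over one period is at most the increment of
    [V], and the sum over the periods telescopes. *)
Lemma Rintegral_wealth_le a b (ts : seq {nonneg R}) (t : {nonneg R})
    (v : Dspace R -> nat) :
  path_times t ts -> discrete_measurable (v : Ft t -> nat) ->
  let W w := wealth a b (v w) (X t w) [seq X s w | s <- ts] in
  P.-integrable setT (EFin \o W) /\ \int[P]_w W w <= V (last t ts) - V t.
Proof.
have [_ _ qV] := qP.
elim: ts t v => [|s ts IH] t v /=.
  move=> _ _; split; last by rewrite Rintegral_probability_cst subrr.
  by apply: (@integrable_bounded _ _ _ _ (cst 0) 0) => // x; rewrite normr0.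
move=> /andP[ts_ pts] mv.
have [iW WV] := IH s _ pts (discrete_measurable_phase_step a b ts_ mv).
have FB : natural_filtration t [set w | odd (v w)] by exact: (mv odd).
have mB : measurable ([set w | odd (v w)] : set (Dspace R)).
  exact: natural_filtration_measurable FB.
have E : (fun w => (odd (v w))%:R * (X s w - X t w)) =
    (fun w => \1_[set w | odd (v w)] w * (X s w - X t w)).
  apply/funext => w; congr (_ * _); rewrite indicE; congr (nat_of_bool _)%:R.
  by apply/idP/idP => [h|/set_mem//]; exact: mem_set.
have i1 : P.-integrable setT (EFin \o (fun w => (odd (v w))%:R * (X s w - X t w))).
  rewrite E; apply: integrable_indic_mul => //.
  exact: (integrableB measurableT (iX s) (iX t)).
split; first exact: (integrableD measurableT i1 iW).
rewrite RintegralD// -[leRHS](subrKA (V s)) addrC lerD//.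
rewrite E Rintegral_indic_mul.
exact: le_trans (ler_norm _) (qV _ _ _ ts_ FB).
Qed.

Lemma quasimartingale_nondecreasing (s t : {nonneg R}) :
  s%:num <= t%:num -> V s <= V t.
Proof.
move=> st; rewrite -subr_ge0; have [_ _ qV] := qP.
apply: le_trans (qV s t setT st _) => //.
by have := coordinate_adapted (lexx s%:num) measurableT.
Qed.

Let bits a b (ts : seq {nonneg R}) w := [seq level_bits a b (X t w) | t <- ts].

Lemma discrete_measurable_bits a b ts :
  discrete_measurable (bits a b ts : Dspace R -> seq (bool * bool)).
Proof.
rewrite /bits; elim: ts => [|t ts IH]; first exact: discrete_measurable_cst.
have mX c : measurable ([set w | c < X t w] : set (Dspace R)).
  by apply: measurable_superlevel; exact: measurable_coordinate.
have h1 := discrete_measurable_bind (fun n c => (n, c)) IH (mX a).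
exact: (discrete_measurable_bind (fun n c => (n.2, c) :: n.1) h1 (mX b)).
Qed.

Lemma measurable_phase_event a b v0 m ts :
  measurable ([set w | (m <= phase v0 (bits a b ts w))%N] : set (Dspace R)).
Proof. exact: (discrete_measurable_bits a b ts [set l | (m <= phase v0 l)%N]). Qed.

Lemma path_times_le t ts : path_times t ts -> t%:num <= (last t ts)%:num.
Proof.
by elim: ts t => [|s ts IH] t //= /andP[ts_ /IH]; exact: le_trans.
Qed.

Let first_phase v0 a b t w := phase_step v0 (level_bits a b (X t w)).

Let integrable_wealth a b v0 t ts : path_times t ts ->
  let W w := wealth a b (first_phase v0 a b t w) (X t w) [seq X s w | s <- ts] in
  P.-integrable setT (EFin \o W) /\ \int[P]_w W w <= V (last t ts).
Proof.
move=> pts W.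
have mv : discrete_measurable ((fun _ => v0) : Ft t -> nat).
  exact: discrete_measurable_cst.
have [iW WV] := Rintegral_wealth_le a b pts
  (discrete_measurable_phase_step a b (lexx _) mv).
by split => //; apply: le_trans WV _; rewrite lerBlDr lerDl.
Qed.

(** On the event, the gain is at least [(b - a) * m] up to the values of the first and last
    positions. The 3 covers the mean gain and the means of |X| at both end times. The start
    [v0 = 1], with a unit already held, serves to detect a single passage above [b]. *)
Lemma crossing_probability_le a b v0 m t ts (N : {nonneg R}) : a < b ->
  (v0 <= 1)%N -> path_times t ts -> (last t ts)%:num <= N%:num ->
  (b - a) * m%:R * fine (P [set w | (m.*2 <= phase v0 (bits a b (t :: ts) w))%N])
    <= 3 * energy P V N + 2 * `|a|.
Proof.
move=> ab v01 pts tsN; have [iW WV] := integrable_wealth a b v0 pts.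
set W := fun w => _ in iW WV.
(* Compensates |X| + |a| at the start, for a unit held initially, and the same at the end, for a
   unit not yet sold. *)
pose f w := W w + (`|X t w| + `|X (last t ts) w| + 2 * `|a|).
have iN s := integrable_norm (iX s).
have ic (c : R) : P.-integrable setT (EFin \o cst c).
  by apply: (@integrable_bounded _ _ _ _ (cst c) `|c|).
have i1 := integrableD measurableT (iN t) (iN (last t ts)).
have i2 := integrableD measurableT i1 (ic (2 * `|a|)).
have fi : P.-integrable setT (EFin \o f) by exact: (integrableD measurableT iW i2).
apply: (@le_trans _ _ (\int[P]_w f w)).
  apply: le_probability_Rintegral => //; first exact: measurable_phase_event.
  move=> w; rewrite indicE.
  have /= := wealth_ge a b (first_phase v0 a b t w) (X t w) [seq X s w | s <- ts].
  rewrite -/(W w) (last_map (fun s => X s w)) -map_comp.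
  have -> : phase (first_phase v0 a b t w)
      [seq (level_bits a b \o X^~ w) i | i <- ts] = phase v0 (bits a b (t :: ts) w) by [].
  set v' := phase v0 _.
  have ->: (w \in [set w0 | (m.*2 <= phase v0 (bits a b (t :: ts) w0))%N]) = (m.*2 <= v')%N.
    by apply/idP/idP => [/set_mem//|?]; exact: mem_set.
  have : (b - a) * (first_phase v0 a b t w)./2%:R +
      (odd (first_phase v0 a b t w))%:R * (X t w - a) <= `|X t w| + `|a|.
    rewrite /first_phase /phase_step /level_bits.
    have hx := ler_norm (X t w); have ha := ler_norm (- a); rewrite normrN in ha.
    have hx0 := normr_ge0 (X t w); have ha0 := normr_ge0 a.
    case: v0 v01 {iW WV W f fi v'} => [|[|//]] _ /=.
      by case: (ltP a) => h /=; lra.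
    by case: (ltP b) => h /=; lra.
  have : (m.*2 <= v')%N%:R * (b - a) * m%:R <= (b - a) * v'./2%:R.
    have [mv|_] := leqP; last by rewrite !mul0r mulr_ge0// subr_ge0 ltW.
    rewrite mul1r ler_pM2l ?subr_gt0// ler_nat.
    by rewrite -[leqLHS]doubleK half_leq.
  have : - (`|X (last t ts) w| + `|a|) <= (odd v')%:R * (X (last t ts) w - a).
    have hx := ler_norm (- X (last t ts) w); have ha := ler_norm a.
    have hx0 := normr_ge0 (X (last t ts) w); have ha0 := normr_ge0 a.
    by rewrite normrN in hx; case: (odd v') => /=; lra.
  by rewrite /f; lra.
have tN : t%:num <= N%:num by apply: le_trans tsN; exact: path_times_le.
rewrite (RintegralD measurableT iW i2) (RintegralD measurableT i1 (ic _)).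
rewrite (RintegralD measurableT (iN t) (iN (last t ts))) Rintegral_probability_cst.
have e1 := Rintegral_norm_le_energy qP t.
have e2 := Rintegral_norm_le_energy qP (last t ts).
have e3 := energy_nondecreasing qP tN.
have e4 := energy_nondecreasing qP tsN.
have e5 := quasimartingale_nondecreasing tsN.
have e6 : 0 <= \int[P]_w jbracket (coordinate N w).
  by apply: Rintegral_ge0 => w _; exact: ltW (jbracket_gt0 _).
have e7 := V0 N.
have e8 : V N <= energy P V N by rewrite /energy; lra.
by rewrite /X in e1 e2 *; lra.
Qed.

(** [crossing_probability_le] with [a = - K] would leave a term 2 K, of the same order as the gain.
    Here a unit bought at or below -K earns K if it is sold above 0, and is worth at least K -
    |X_last| more than its cost if it is still held, so nothing of order K is lost. *)
Lemma lower_excursion_probability_le K t ts (N : {nonneg R}) : 0 < K ->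
  path_times t ts -> (last t ts)%:num <= N%:num ->
  K * fine (P [set w | (1 <= phase 0 (bits (- K) 0 (t :: ts) w))%N])
    <= 3 * energy P V N.
Proof.
move=> K0 pts tsN; have [iW WV] := integrable_wealth (- K) 0 0 pts.
set W := fun w => _ in iW WV.
pose f w := W w + `|X (last t ts) w|.
have iN s := integrable_norm (iX s).
have fi : P.-integrable setT (EFin \o f).
  exact: (integrableD measurableT iW (iN _)).
apply: (@le_trans _ _ (\int[P]_w f w)).
  apply: le_probability_Rintegral => //; first exact: measurable_phase_event.
  move=> w; rewrite indicE.
  have /= := wealth_ge (- K) 0 (first_phase 0 (- K) 0 t w) (X t w) [seq X s w | s <- ts].
  rewrite -/(W w) (last_map (fun s => X s w)) -map_comp.
  have -> : phase (first_phase 0 (- K) 0 t w)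
      [seq (level_bits (- K) 0 \o X^~ w) i | i <- ts] = phase 0 (bits (- K) 0 (t :: ts) w) by [].
  set v' := phase 0 _.
  have ->: (w \in [set w0 | (1 <= phase 0 (bits (- K) 0 (t :: ts) w0))%N]) = (1 <= v')%N.
    by apply/idP/idP => [/set_mem//|?]; exact: mem_set.
  have : (0 - - K) * (first_phase 0 (- K) 0 t w)./2%:R +
      (odd (first_phase 0 (- K) 0 t w))%:R * (X t w - - K) <= 0.
    rewrite /first_phase /phase_step /level_bits /=.
    by case: (ltP (- K)) => h /=; lra.
  have : K * (1 <= v')%N%:R - `|X (last t ts) w| <=
      (0 - - K) * v'./2%:R + (odd v')%:R * (X (last t ts) w - - K).
    have hx := ler_norm (- X (last t ts) w).
    have hx0 := normr_ge0 (X (last t ts) w).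
    rewrite normrN in hx; have h0 : 0 <= K * v'./2%:R by rewrite mulr_ge0// ltW.
    have [ov|ev] := boolP (odd v'); first by rewrite (odd_gt0 ov) /=; lra.
    have [->|v'0] := posnP v'; first by rewrite /=; lra.
    have : K * 1 <= K * v'./2%:R.
      by rewrite ler_pM2l// ler1n half_gt0; case: (v') v'0 ev => [|[]].
    by rewrite /=; lra.
  by rewrite /f; lra.
rewrite (RintegralD measurableT iW (iN (last t ts))).
have e2 := Rintegral_norm_le_energy qP (last t ts).
have e4 := energy_nondecreasing qP tsN.
have e5 := quasimartingale_nondecreasing tsN.
have e6 : 0 <= \int[P]_w jbracket (coordinate N w).
  by apply: Rintegral_ge0 => w _; exact: ltW (jbracket_gt0 _).
have e7 := V0 N.
have e8 : V N <= energy P V N by rewrite /energy; lra.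
by rewrite /X in e2 *; lra.
Qed.

End crossings.

(** * Compactness for laws of bits *)

Lemma frequently_subsequence (Q : nat -> nat -> Prop) :
  (forall m N, exists2 n, (N <= n)%N & Q m n) ->
  exists k : nat -> nat, {homo k : i j / (i < j)%N} /\ forall m, Q m (k m).
Proof.
move=> h.
have /choice[nx nxP] : forall mN : nat * nat,
    exists n, (mN.2 <= n)%N /\ Q mN.1 n.
  by move=> [m N]; have [n] := h m N; exists n.
pose k := fix k m := if m is m'.+1 then nx (m, (k m').+1) else nx (0, 0)%N.
exists k; split; last first.
  by case=> [|m]; [exact: (nxP (0, 0)%N).2|exact: (nxP (m.+1, (k m).+1)).2].
apply: homo_ltn; first exact: ltn_trans.
by move=> m; exact: (nxP (m.+1, (k m).+1)).1.
Qed.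

(** Tychonoff's theorem on a product of segments gives a cluster point, and countability of [I] lets
    a subsequence reach it. *)
Lemma diagonal_subsequence (R : realType) (I : countType) (x : nat -> I -> R) :
  (forall i, exists C, forall n, `|x n i| <= C) ->
  exists (k : nat -> nat) (l : I -> R), {homo k : i j / (i < j)%N} /\
    forall i, x (k n) i @[n --> \oo] --> l i.
Proof.
move=> /choice[C xC].
pose PT := prod_topology (fun _ : I => R).
have Kco := @tychonoff I (fun _ => R) (fun i => `[- C i, C i]%classic)
  (fun i => @segment_compact R _ _).
have [|l [_ lcl]] := Kco (x @ \oo) _.
  by exists 0%N => // n _ i /=; rewrite in_itv/= -ler_norml.
(* Controls the coordinates of code below [m] up to 1 / (m + 1): each coordinate is eventually
   controlled, with a precision tending to 0. *)
pose U m := [set f : I -> R | forall i, (pickle i < m)%N ->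
  `|l i - f i| < m.+1%:R^-1].
have Fl : Filter (nbhs (l : PT)) := nbhs_filter (l : PT).
have nU m : nbhs (l : PT) (U m).
  suff H e j : 0 < e -> nbhs (l : PT)
      [set f : I -> R | forall i, (pickle i < j)%N -> `|l i - f i| < e].
    by apply: H.
  move=> e0; elim: j => [|j IH]; first by apply: filterS filterT => f _ i.
  case E : (@unpickle I j) => [i0|]; last first.
    apply: filterS IH => f fl i; rewrite ltnS leq_eqVlt => /predU1P[ij|]; last exact: fl.
    by move: E; rewrite -ij pickleK.
  have h : nbhs (l : PT) [set f : I -> R | `|l i0 - f i0| < e].
    have := @proj_continuous I (fun _ => R) i0 l.
    move=> /(_ [set y | `|l i0 - y| < e]); apply.
    by have := @nbhsx_ballx R R (l i0) e e0.
  apply: filterS2 IH h => f fl fi0 i; rewrite ltnS leq_eqVlt.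
  case/predU1P => [ij|]; last exact: fl.
  by move: E; rewrite -ij pickleK => -[->].
have freq m N : exists2 n, (N <= n)%N & U m (x n).
  have [] := lcl (x @` [set n | (N <= n)%N]) (U m) _ (nU m).
    by exists N => // n /= Nn; exists n.
  by move=> _ [[n Nn <-] Un]; exists n.
have [k [kh kU]] := frequently_subsequence freq.
exists k, l; split => // i.
apply/cvgrPdist_lt => e e0.
have [m0 m0e] : exists m0 : nat, e^-1 < m0.+1%:R.
  by exists (Num.trunc e^-1); exact: truncnS_gt.
near=> m; apply: lt_le_trans (kU m i _) _.
  by near: m; exact: nbhs_infty_gt.
rewrite invf_ple ?posrE// (le_trans (ltW m0e))// ler_nat ltnS.
by near: m; exact: nbhs_infty_ge.
Unshelve. all: by end_near. Qed.

Section nested_intervals.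
Context {R : realType} (p : seq bool -> R).
Hypotheses (p_nil : p [::] = 1) (p_ge0 : forall s, 0 <= p s)
  (p_split : forall s, p s = p (false :: s) + p (true :: s)).

(* Left end of the subinterval of [0, 1[ of length p s attached to s, the last
   bit coming first. *)
Fixpoint left_end (s : seq bool) : R :=
  if s is c :: s' then left_end s' + (if c then p (false :: s') else 0) else 0.

(** The subinterval of [s] is cut into a left child (bit false) and a right child (bit true); the
    new bit is the side of the cut on which [u] lies. *)
Definition address_step (u : R) (s : seq bool) : seq bool :=
  (left_end s + p (false :: s) <= u) :: s.

Definition address (m : nat) (u : R) : seq bool := iter m (address_step u) [::].

Let itv s := [set u | left_end s <= u < left_end s + p s].

Lemma size_address m u : size (address m u) = m.
Proof. by elim: m => //= m ->. Qed.

Lemma left_end_ge0 s : 0 <= left_end s.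
Proof. by elim: s => //= -[] s h; rewrite addr_ge0. Qed.

Lemma left_end_le1 s : left_end s + p s <= 1.
Proof.
elim: s => [|c s IH] /=; first by rewrite add0r p_nil.
apply: le_trans IH; rewrite -addrA lerD2l (p_split s).
by case: c; rewrite ?add0r// lerDl.
Qed.

Lemma addressP m u : 0 <= u < 1 -> itv (address m u) u.
Proof.
move=> u01; elim: m => [|m IH]; first by rewrite /itv /= p_nil add0r.
rewrite /address iterS -/(address m u) /address_step.
move: IH; set s := address m u => /andP[h1 h2].
rewrite /itv /=; have [h|h] := leP (left_end s + p (false :: s)) u.
  by rewrite h /= -addrA -p_split.
by rewrite addr0 h1.
Qed.

Lemma address_eq s u : itv s u -> address (size s) u = s.
Proof.
elim: s => [|c s IH]//= /andP[h1 h2].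
have su : itv s u.
  apply/andP; split; first by apply: le_trans h1; case: c {h2}; rewrite ?addr0// lerDl.
  apply: lt_le_trans h2 _; rewrite -addrA lerD2l (p_split s).
  by case: c {h1}; rewrite ?add0r// lerDl.
rewrite -[LHS]/(address_step u (address (size s) u)) (IH su) /address_step.
congr (_ :: _); case: c h1 h2 => /= h1 h2; first by apply/idP.
by apply/negbTE; rewrite -ltNge; rewrite addr0 in h2.
Qed.

Lemma discrete_measurable_address m :
  discrete_measurable (address m : measurableTypeR R -> seq bool).
Proof.
rewrite /address => Q; elim: m [::] Q => [|m IH] s Q.
  exact: discrete_measurable_cst.
rewrite (_ : _ @^-1` Q = (`[left_end s + p (false :: s), +oo[%classic `&`
    [set u | Q (iter m (address_step u) (true :: s))]) `|`
  (~` `[left_end s + p (false :: s), +oo[%classic `&`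
    [set u | Q (iter m (address_step u) (false :: s))])).
  apply: measurableU; apply: measurableI; try exact: (IH (_ :: _) Q).
    exact: measurable_itv.
  by apply: measurableC; exact: measurable_itv.
apply/seteqP; split=> u /=; rewrite -iterS iterSr /address_step in_itv/= andbT.
  by case: (leP _ u) => h q; [left|right].
by case: (leP _ u) => h [[]|[]].
Qed.

Lemma uniform_itv s : uniform_prob (@ltr01 R) (itv s) = (p s)%:E.
Proof.
rewrite /uniform_prob integral_uniform_pdf.
have -> : itv s `&` `[0, 1] = `[left_end s, left_end s + p s[%classic.
  apply/seteqP; split=> u /=; rewrite !in_itv/= /itv/=; first by case.
  move=> /andP[h1 h2]; rewrite h1 h2; split => //; rewrite (le_trans (left_end_ge0 s) h1)/=.
  by rewrite ltW// (lt_le_trans h2)// left_end_le1.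
rewrite (eq_integral (cst 1%E)); last first.
  move=> u; rewrite inE/= in_itv/= => /andP[h1 h2]; rewrite /uniform_pdf.
  rewrite (le_trans (left_end_ge0 s) h1)/= ltW ?(lt_le_trans h2)// ?left_end_le1//.
  by rewrite subr0 invr1.
rewrite integral_cst//= mul1e lebesgue_measure_itv/= lte_fin.
case: ltP => [_|]; first by rewrite -EFinB addrAC subrr add0r.
by rewrite gerDl => ps; congr EFin; apply/eqP; rewrite eq_le p_ge0 ps.
Qed.

(** Inside [0, 1[ the points of address [s] are those of the subinterval of [s]. Points outside have
    addresses too, but form a null set, the complement of the interval of the empty word. *)
Lemma uniform_address s :
  uniform_prob (@ltr01 R) [set u | address (size s) u = s] = (p s)%:E.
Proof.
have mA : measurable [set u : measurableTypeR R | address (size s) u = s].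
  exact: (@discrete_measurable_address (size s) [set l | l = s]).
have mI s' : measurable (itv s' : set (measurableTypeR R)).
  rewrite (_ : itv s' = `[left_end s', left_end s' + p s'[%classic).
    exact: measurable_itv.
  by apply/seteqP; split => u /=; rewrite in_itv.
apply/eqP; rewrite eq_le -{2}uniform_itv; apply/andP; split; last first.
  by apply: le_measure; rewrite ?inE// => u /address_eq.
have C0 : uniform_prob (@ltr01 R) (~` itv [::]) = 0%E.
  have h := uniform_itv [::]; rewrite p_nil in h.
  apply: (eq_trans (probability_setC (uniform_prob (@ltr01 R)) (mI [::]))).
  by rewrite [X in (1 - X)%E]h subee.
apply: (@le_trans _ _ (uniform_prob (@ltr01 R) (itv s `|` ~` itv [::]))).
  apply: le_measure; rewrite ?inE//.
    by apply: measurableU => //; exact: measurableC.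
  move=> u /= us; have [u01|u01] := pselect (itv [::] u); last by right.
  left; rewrite -us; apply: addressP; move: u01.
  by rewrite /itv /= add0r p_nil.
apply: le_trans (measureU2 _ (mI s) (measurableC (mI [::]))) _.
by rewrite [X in (_ + X)%E]C0 adde0 -uniform_itv.
Qed.

End nested_intervals.

Lemma rev_growing (D : Type) (L : nat -> seq D) (c : nat -> D) :
  L 0 = [::] -> (forall m, L m.+1 = c m :: L m) ->
  forall m, rev (L m) = mkseq c m.
Proof.
by move=> L0 LS; elim=> [|m IH]; rewrite ?L0// LS rev_cons IH mkseqS.
Qed.

Lemma Rintegral_finite_word d (T : measurableType d) (R : realType)
    (P : probability T R) (l : T -> seq bool) (m : nat) (F : seq bool -> R) :
  discrete_measurable l -> (forall x, size (l x) = m) ->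
  \int[P]_x F (l x) =
    \sum_(s : m.-tuple bool) F s * fine (P [set x | l x = s]).
Proof.
move=> ml lm.
have mE s : measurable [set x | l x = s] by exact: (ml [set l' | l' = s]).
have iE s : P.-integrable setT (EFin \o \1_[set x | l x = s]).
  by apply: integrable_indic; exact: mE.
have iF s : P.-integrable setT (EFin \o (fun x => F s * \1_[set x | l x = s] x)).
  by apply: (@integrable_bounded_mul _ _ _ _ (cst (F s)) _ `|F s|).
transitivity (\int[P]_x \sum_(s : m.-tuple bool) F s * \1_[set x | l x = s] x).
  apply: eq_Rintegral => x _.
  rewrite (bigD1 (Tuple (introT eqP (lm x))))//= big1 ?addr0.
    by rewrite indicE mem_set ?mulr1.
  move=> s; rewrite -val_eqE/= => sx; rewrite indicE memNset ?mulr0//=.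
  by move=> xs; rewrite xs eqxx in sx.
rewrite Rintegral_sum//; apply: eq_bigr => s _.
rewrite RintegralZl//; congr (_ * fine _).
by rewrite integral_indic// setIT.
Qed.

(** The probabilities of finite words are countably many numbers in [0, 1]; their limits along a
    subsequence keep the consistency relation [p_split]. Finitely many bits take finitely many
    values, so [F] can be arbitrary, without continuity. The extra family [g] will be the energies
    at rational times. *)
Lemma bits_limit (R : realType) (J I : countType) d (T : measurableType d)
    (P : nat -> probability T R) (b : J -> T -> bool) (g : nat -> I -> R) :
  (forall j, measurable [set x | b j x]) ->
  (forall i, exists C, forall n, `|g n i| <= C) ->
  exists k : nat -> nat, {homo k : i j / (i < j)%N} /\
  exists l : I -> R, (forall i, g (k n) i @[n --> \oo] --> l i) /\
  exists d' (Om : measurableType d') (mu : probability Om R) (c : J -> Om -> bool),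
    (forall j, measurable [set u | c j u]) /\
    forall (js : seq J) (F : seq bool -> R),
      \int[P (k n)]_x F [seq b j x | j <- js] @[n --> \oo] -->
      \int[mu]_u F [seq c j u | j <- js].
Proof.
move=> mb gC.
pose b' n x := if @unpickle J n is Some j then b j x else false.
have mb' n : measurable [set x | b' n x].
  rewrite /b'; case: (unpickle n) => [j|]//.
  by rewrite (_ : [set x | _] = set0)//; apply/seteqP; split.
pose word := fix word m x := if m is m'.+1 then b' m' x :: word m' x else [::].
have word_size m x : size (word m x) = m by elim: m => //= m ->.
have mword m : discrete_measurable (word m).
  elim: m => [|m IH]; first exact: discrete_measurable_cst.
  exact: (discrete_measurable_bind (fun s c => c :: s) IH (mb' m)).
have mwE m s : measurable [set x | word m x = s].
  exact: (mword m [set s' | s' = s]).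
pose pn n s := fine (P n [set x | word (size s) x = s]).
(* Indexing by a sum type makes one subsequence serve both the words and [g]. *)
pose gg n (i : seq bool + I) := match i with inl s => pn n s | inr i => g n i end.
have [|k [l [kh gl]]] := @diagonal_subsequence R _ gg.
  case=> [s|i]; last exact: gC.
  exists 1 => n; rewrite /gg /pn ger0_norm ?fine_ge0//.
  rewrite -lee_fin fineK ?fin_num_measure//; exact: probability_le1.
exists k; split => //; exists (l \o inr); split; first by move=> i; exact: (gl (inr i)).
pose p := l \o inl.
have pl s : pn (k n) s @[n --> \oo] --> p s by exact: (gl (inl s)).
have p_nil : p [::] = 1.
  apply/esym; apply: cvg_unique (pl [::]) => //.
  rewrite (_ : (fun n => _) = cst 1); first exact: cvg_cst.
  apply/funext => n; rewrite /pn /=.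
  rewrite (_ : [set x | _] = setT); last by apply/seteqP; split.
  by rewrite probability_setT.
have p_ge0 s : 0 <= p s.
  apply: cvgr_to_ge (pl s) _.
  by apply: nearW => n; rewrite fine_ge0.
have p_split s : p s = p (false :: s) + p (true :: s).
  apply: cvg_unique (pl s) _ => //.
  rewrite (_ : (fun n => pn (k n) s) =
    (fun n => pn (k n) (false :: s) + pn (k n) (true :: s))).
    by apply: cvgD; exact: pl.
  apply/funext => n; rewrite /pn -fineD ?fin_num_measure//.
  rewrite -measureU//; last first.
    by apply/seteqP; split => // x [/= [-> _] []].
  congr (fine (_ _)); apply/seteqP; split=> x /=.
    by move=> ->; case: (b' _ x); [right|left].
  by case=> -[].
exists _, (measurableTypeR R), (uniform_prob (@ltr01 R)).
pose c' n (u : measurableTypeR R) := head false (address p n.+1 u).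
have addressS m u : address p m.+1 u = c' m u :: address p m u by [].
have maddress m := discrete_measurable_address p m.
have mc' m : measurable [set u | c' m u].
  exact: (maddress m.+1 [set s | head false s]).
exists (fun j => c' (pickle j)); split; first by move=> j; exact: mc'.
move=> js F.
pose m := (\max_(j <- js) (pickle j).+1)%N.
have jm j : j \in js -> (pickle j < m)%N.
  by move=> jjs; rewrite /m (big_rem j jjs)/= leq_max leqnn.
pose F' s := F [seq nth false (rev s) (pickle j) | j <- js].
have wF x : F [seq b j x | j <- js] = F' (word m x).
  congr F; apply/eq_in_map => j /jm jj.
  rewrite (rev_growing (L := fun m => word m x) (c := fun m => b' m x))//.
  by rewrite nth_mkseq// /b' pickleK.
have aF u : F [seq c' (pickle j) u | j <- js] = F' (address p m u).
  congr F; apply/eq_in_map => j /jm jj.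
  rewrite (rev_growing (L := fun m => address p m u) (c := fun m => c' m u))//.
  by rewrite nth_mkseq.
have -> : \int[uniform_prob (@ltr01 R)]_u F [seq c' (pickle j) u | j <- js] =
    \sum_(s : m.-tuple bool) F' s * p s.
  under eq_Rintegral do rewrite aF.
  rewrite (Rintegral_finite_word _ _ (maddress m) (size_address p m)).
  apply: eq_bigr => s _; congr (_ * _).
  by have := uniform_address p_nil p_ge0 p_split s; rewrite size_tuple => /(congr1 fine).
rewrite (_ : (fun n => \int[P (k n)]_x F [seq b j x | j <- js]) =
    (fun n => \sum_(s : m.-tuple bool) F' s * pn (k n) s)); last first.
  apply/funext => n; under eq_Rintegral do rewrite wF.
  rewrite (Rintegral_finite_word _ _ (mword m) (word_size m)).
  by apply: eq_bigr => s _; rewrite /pn size_tuple.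
apply: cvg_big => [|s _]; first exact: add_continuous.
apply: cvgM; first exact: cvg_cst.
exact: pl.
Qed.

(** * Cadlag regularization *)

Section cut.
Context {R : realType} (c : rat -> rat -> bool).
Hypothesis c_mono : forall s q q', q <= q' -> c s q' -> c s q.

(** A Dedekind cut along the filter: [L] is the supremum of the levels eventually exceeded. The
    bound [K] makes it finite, and the absence of oscillation between two levels decides all levels
    above [L]. *)
Lemma cut_value (U : set_system rat) (K : rat) : ProperFilter U ->
  U [set s | c s (- K)] -> U [set s | ~~ c s K] ->
  (forall q q', q < q' -> U [set s | c s q] \/ U [set s | ~~ c s q']) ->
  exists L : R, (forall q, ratr q < L -> U [set s | c s q]) /\
                (forall q, L < ratr q -> U [set s | ~~ c s q]).
Proof.
move=> FU UNK UK Ucut.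
pose S := (ratr : rat -> R) @` [set q | U [set s | c s q]].
have lt_of q q' : U [set s | c s q] -> U [set s | ~~ c s q'] -> q < q'.
  move=> h h'; have [s [/= h1 h2]] := filter_ex (filterI h h').
  by rewrite ltNge; apply: contra h2 => qq'; exact: c_mono qq' h1.
have S0 : S !=set0 by exists (ratr (- K)); exists (- K).
have SK : ubound S (ratr K) by move=> _ [q h <-]; rewrite ler_rat ltW// (lt_of _ _ h).
have supS : has_sup S by split => //; exists (ratr K).
exists (sup S); split => q.
  move=> /(sup_gt supS.1) [_ [q' h <-]].
  rewrite ltr_rat => /ltW qq'; apply: filterS h => s /=; exact: c_mono.
move=> Lq; have [r] := rat_in_itvoo Lq; rewrite in_itv/= => /andP[Lr].
rewrite ltr_rat => rq; have [h|//] := Ucut _ _ rq.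
by move: Lr; rewrite ltNge; case/negP; apply: ub_le_sup; [exists (ratr K)|exists r].
Qed.

End cut.

Section germs.
Context {R : realType}.
Implicit Types t : R.

(** [t] itself is left out, so that the germ describes a right limit and ignores the bits at [t]. *)
Definition right_germ t : set_system rat :=
  [set A | exists2 e, 0 < e & forall s, t < ratr s < t + e -> A s].

Definition left_germ t : set_system rat :=
  [set A | exists2 e, 0 < e & forall s, t - e < ratr s < t -> A s].

Lemma right_germ_filter t : ProperFilter (right_germ t).
Proof.
split.
  move=> [e e0]; have [|s] := @rat_in_itvoo R t (t + e); first by rewrite ltrDl.
  by rewrite in_itv/= => /[swap] /[apply].
split; first by exists 1.
  move=> A B [e e0 eA] [f f0 fB]; exists (Num.min e f); first by rewrite lt_min e0.
  move=> s /andP[ts]; rewrite -ltrBlDl lt_min !ltrBlDl => /andP[se sf].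
  by split; [apply: eA|apply: fB]; rewrite ts.
by move=> A B AB [e e0 eA]; exists e => // s /eA; exact: AB.
Qed.

Lemma left_germ_filter t : ProperFilter (left_germ t).
Proof.
split.
  move=> [e e0]; have [|s] := @rat_in_itvoo R (t - e) t.
    by rewrite ltrBlDr ltrDl.
  by rewrite in_itv/= => /[swap] /[apply].
split; first by exists 1.
  move=> A B [e e0 eA] [f f0 fB]; exists (Num.min e f); first by rewrite lt_min e0.
  move=> s /andP[+ st]; rewrite ltrBlDr -ltrBlDl lt_min !ltrBlDl => /andP[se sf].
  by split; [apply: eA|apply: fB]; rewrite st andbT ltrBlDr.
by move=> A B AB [e e0 eA]; exists e => // s /eA; exact: AB.
Qed.

Let bits (c : rat -> rat -> bool) q q' (s : seq rat) := [seq (c r q, c r q') | r <- s].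

(** If both properties fail near [t], every right neighbourhood of [t] contains a time at which the
    phase advances, whatever its parity. *)
Lemma right_alternation (c : rat -> rat -> bool) q q' t :
  ~ right_germ t [set s | c s q] -> ~ right_germ t [set s | ~~ c s q'] ->
  forall m v e, 0 < e -> exists2 ss : seq rat, sorted <%R ss /\
    (forall s, s \in ss -> t < ratr s < t + e) &
    (v + m <= phase v (bits c q q' ss))%N.
Proof.
move=> n1 n2; suff H m v e : 0 < e -> exists2 ss : seq rat, sorted <%R ss /\
    (exists2 f, 0 < f & forall s, s \in ss -> t + f < ratr s < t + e) &
    (v + m <= phase v (bits c q q' ss))%N.
  move=> m v e e0; have [ss [ss1 [f f0 ss2] ss3]] := H m v e e0.
  exists ss => //; split => // s /ss2 /andP[h ->]; rewrite andbT.
  by apply: lt_trans h; rewrite ltrDl.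
elim: m v e => [|m IH] v e e0.
  by exists [::]; [split => //; exists 1|rewrite addn0].
have [ss [ss1 [f f0 ss2] ss3]] := IH v.+1 e e0.
have g0 : 0 < Num.min f e by rewrite lt_min f0.
have [s /andP[ts sg] sv] : exists2 s, t < ratr s < t + Num.min f e &
    phase_step v (c s q, c s q') = v.+1.
  apply: contrapT => h; have [ov|ev] := boolP (odd v).
    apply: n2; exists (Num.min f e) => // s ts.
    apply/negP => cs; apply: h; exists s => //.
    by rewrite /phase_step ov /= cs addn1.
  apply: n1; exists (Num.min f e) => // s ts.
  apply/negPn/negP => cs; apply: h; exists s => //.
  by rewrite /phase_step (negbTE ev) /= cs addn1.
move: sg; rewrite -ltrBlDl lt_min !ltrBlDl => /andP[sf se].
exists (s :: ss); last by rewrite /= sv addnS -addSn.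
split.
  rewrite /= path_sortedE; last exact: lt_trans.
  rewrite ss1 andbT; apply/allP => r /ss2 /andP[h _].
  by rewrite -(ltr_rat R) (lt_trans sf).
exists ((ratr s - t) / 2); first by rewrite divr_gt0// subr_gt0.
move=> r; rewrite inE => /predU1P[->|/ss2 /andP[h1 ->]].
  by rewrite se andbT; lra.
by rewrite andbT; lra.
Qed.

(** Here times are found in increasing order, each in the gap between the previous one and [t]. *)
Lemma left_alternation (c : rat -> rat -> bool) q q' t :
  ~ left_germ t [set s | c s q] -> ~ left_germ t [set s | ~~ c s q'] ->
  forall m v e, 0 < e -> exists2 ss : seq rat, sorted <%R ss /\
    (forall s, s \in ss -> t - e < ratr s < t) &
    (v + m <= phase v (bits c q q' ss))%N.
Proof.
move=> n1 n2; elim=> [|m IH] v e e0; first by exists [::]; rewrite ?addn0.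
have [s /andP[se st] sv] : exists2 s, t - e < ratr s < t &
    phase_step v (c s q, c s q') = v.+1.
  apply: contrapT => h; have [ov|ev] := boolP (odd v).
    apply: n2; exists e => // s ts.
    apply/negP => cs; apply: h; exists s => //.
    by rewrite /phase_step ov /= cs addn1.
  apply: n1; exists e => // s ts.
  apply/negPn/negP => cs; apply: h; exists s => //.
  by rewrite /phase_step (negbTE ev) /= cs addn1.
have [|ss [ss1 ss2] ss3] := IH v.+1 (t - ratr s); first by rewrite subr_gt0.
exists (s :: ss); last by rewrite /= sv addnS -addSn.
split.
  rewrite /= path_sortedE; last exact: lt_trans.
  rewrite ss1 andbT; apply/allP => r /ss2 /andP[].
  by rewrite opprB addrC subrK ltr_rat.
move=> r; rewrite inE => /predU1P[->|/ss2 /andP[h1 ->]]; first by rewrite se st.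
by rewrite andbT; move: h1; rewrite opprB addrC subrK; exact: lt_trans.
Qed.

(* c s q is meant as: the path exceeds the level q at the rational time s. The
   three conditions forbid, on compact time intervals, infinitely many crossings
   and unboundedness. *)
Definition regular_code (c : rat -> rat -> bool) : Prop :=
  [/\ forall s q q', q <= q' -> c s q' -> c s q,
      forall (N : nat) q q', q < q' -> exists m, forall ss : seq rat,
        sorted <%R ss -> (forall s, s \in ss -> 0 <= s <= N%:R) ->
        (phase 0 (bits c q q' ss) < m)%N &
      forall N : nat, exists K : nat, forall s, 0 <= s <= N%:R ->
        c s (- K%:R) && ~~ c s K%:R].

Lemma nat_ge (x : R) : exists N : nat, x <= N%:R.
Proof.
have [x0|x0] := leP 0 x; last by exists 0%N; exact: ltW.
by exists (Num.trunc x).+1; exact/ltW/truncnS_gt.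
Qed.

Lemma regular_right_value (c : rat -> rat -> bool) t : regular_code c -> 0 <= t ->
  exists L : R, (forall q, ratr q < L -> right_germ t [set s | c s q]) /\
                (forall q, L < ratr q -> right_germ t [set s | ~~ c s q]).
Proof.
move=> [c1 c2 c3] t0; have FU := right_germ_filter t.
have [N tN] := nat_ge (t + 1).
have in0N s : t < ratr s < t + 1 -> 0 <= s <= N%:R.
  move=> /andP[h1 h2]; apply/andP; split; rewrite -(ler_rat R) ?rmorph0 ?ratr_nat.
    exact: le_trans t0 (ltW h1).
  exact: le_trans (ltW h2) tN.
have [K cK] := c3 N.
apply: (cut_value c1 (K := K%:R)) => //.
- by exists 1 => // s /in0N /cK /andP[].
- by exists 1 => // s /in0N /cK /andP[].
move=> q q' qq'; apply: contrapT => /not_orP[n1 n2].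
have [m cm] := c2 N _ _ qq'.
have [ss [ss1 ss2]] := right_alternation n1 n2 m 0 ltr01.
by rewrite add0n leqNgt cm// => s /ss2; exact: in0N.
Qed.

Lemma regular_left_value (c : rat -> rat -> bool) t : regular_code c -> 0 < t ->
  exists L : R, (forall q, ratr q < L -> left_germ t [set s | c s q]) /\
                (forall q, L < ratr q -> left_germ t [set s | ~~ c s q]).
Proof.
move=> [c1 c2 c3] t0; have FU := left_germ_filter t.
have [N tN] := nat_ge t.
have in0N s : t - t < ratr s < t -> 0 <= s <= N%:R.
  rewrite subrr => /andP[h1 h2]; apply/andP; split; rewrite -(ler_rat R) ?rmorph0 ?ratr_nat.
    exact: ltW h1.
  exact: le_trans (ltW h2) tN.
have [K cK] := c3 N.
apply: (cut_value c1 (K := K%:R)) => //.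
- by exists t => // s /in0N /cK /andP[].
- by exists t => // s /in0N /cK /andP[].
move=> q q' qq'; apply: contrapT => /not_orP[n1 n2].
have [m cm] := c2 N _ _ qq'.
have [ss [ss1 ss2]] := left_alternation n1 n2 m 0 t0.
by rewrite add0n leqNgt cm// => s /ss2; exact: in0N.
Qed.

Definition right_values (c : rat -> rat -> bool) (y : {nonneg R} -> R) : Prop :=
  forall (t : {nonneg R}) q, (ratr q < y t -> right_germ t%:num [set s | c s q]) /\
              (y t < ratr q -> right_germ t%:num [set s | ~~ c s q]).

Lemma right_values_ge (c : rat -> rat -> bool) y (t : {nonneg R}) (q : rat) :
  (forall s q q', q <= q' -> c s q' -> c s q) ->
  right_values c y -> right_germ t%:num [set s | c s q] -> ratr q <= y t.
Proof.
move=> c1 cy h; rewrite leNgt; apply/negP => /(cy t q).2 h'.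
have FU := right_germ_filter t%:num.
by have [s [/= cs /negP]] := filter_ex (filterI h h').
Qed.

Lemma right_values_le (c : rat -> rat -> bool) y (t : {nonneg R}) (q : rat) :
  (forall s q q', q <= q' -> c s q' -> c s q) ->
  right_values c y -> right_germ t%:num [set s | ~~ c s q] -> y t <= ratr q.
Proof.
move=> c1 cy h; rewrite leNgt; apply/negP => /(cy t q).1 h'.
have FU := right_germ_filter t%:num.
by have [s [/= /negP cs /cs]] := filter_ex (filterI h h').
Qed.

(** A right neighbourhood of [t] is also one of each of its points: bits that are constant just
    after [t], at two levels around [y t], confine [y] at all these points. *)
Lemma regular_code_cadlag c : regular_code c ->
  exists2 y : {nonneg R} -> R, cadlag y & right_values c y.
Proof.
move=> rc; have [c1 _ _] := rc.
have /choice[y cy] : forall t : {nonneg R}, exists L : R, forall q,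
    (ratr q < L -> right_germ t%:num [set s | c s q]) /\
    (L < ratr q -> right_germ t%:num [set s | ~~ c s q]).
  move=> t; have [L [h1 h2]] := regular_right_value rc (ge0 t).
  by exists L => q; split; [exact: h1|exact: h2].
exists y => //; split => t.
  apply/cvgrPdist_le => e e0.
  have [q1] := @rat_in_itvoo R (y t - e) (y t) ltac:(lra).
  have [q2] := @rat_in_itvoo R (y t) (y t + e) ltac:(lra).
  rewrite !in_itv/= => /andP[q21 q22] /andP[q11 q12].
  have [f1 f10 h1] := (cy t q1).1 q12.
  have [f2 f20 h2] := (cy t q2).2 q21.
  near=> r.
  have tr : t%:num < r by near: r; exact: nbhs_right_gt.
  have rf1 : r < t%:num + f1 by near: r; apply: nbhs_right_lt; rewrite ltrDl.
  have rf2 : r < t%:num + f2 by near: r; apply: nbhs_right_lt; rewrite ltrDl.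
  rewrite /extend; set r' := NngNum _.
  have r'E : r'%:num = r by apply/max_idPr; rewrite (le_trans _ (ltW tr)).
  have y1 : ratr q1 <= y r'.
    apply: (right_values_ge c1 cy); rewrite r'E; exists (t%:num + f1 - r).
      by rewrite subr_gt0.
    move=> s /andP[rs sf]; apply: h1; rewrite (lt_trans tr rs)/=.
    by move: sf; rewrite addrC subrK.
  have y2 : y r' <= ratr q2.
    apply: (right_values_le c1 cy); rewrite r'E; exists (t%:num + f2 - r).
      by rewrite subr_gt0.
    move=> s /andP[rs sf]; apply: h2; rewrite (lt_trans tr rs)/=.
    by move: sf; rewrite addrC subrK.
  by rewrite ler_distl; apply/andP; split; lra.
(* The left limit is the cut [L] along the left germ, possibly different from [y t]; right germs at
   times just before [t] are confined in the same way. *)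
move=> t0; have [L [hL1 hL2]] := regular_left_value rc t0.
apply/cvg_ex; exists L.
apply/cvgrPdist_le => e e0.
have [q1] := @rat_in_itvoo R (L - e) L ltac:(lra).
have [q2] := @rat_in_itvoo R L (L + e) ltac:(lra).
rewrite !in_itv/= => /andP[q21 q22] /andP[q11 q12].
have [f1 f10 h1] := hL1 _ q12.
have [f2 f20 h2] := hL2 _ q21.
near=> r.
have rt : r < t%:num by near: r; exact: nbhs_left_lt.
have r0 : 0 < r by near: r; exact: nbhs_left_gt.
have rf1 : t%:num - f1 < r by near: r; apply: nbhs_left_gt; rewrite ltrBlDr ltrDl.
have rf2 : t%:num - f2 < r by near: r; apply: nbhs_left_gt; rewrite ltrBlDr ltrDl.
rewrite /extend; set r' := NngNum _.
have r'E : r'%:num = r by apply/max_idPr; exact: ltW.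
have y1 : ratr q1 <= y r'.
  apply: (right_values_ge c1 cy); rewrite r'E; exists (t%:num - r).
    by rewrite subr_gt0.
  move=> s /andP[rs sf]; apply: h1; rewrite (lt_trans rf1 rs)/=.
  by move: sf; rewrite addrC subrK.
have y2 : y r' <= ratr q2.
  apply: (right_values_le c1 cy); rewrite r'E; exists (t%:num - r).
    by rewrite subr_gt0.
  move=> s /andP[rs sf]; apply: h2; rewrite (lt_trans rf2 rs)/=.
  by move: sf; rewrite addrC subrK.
by rewrite ler_distl; apply/andP; split; lra.
Unshelve. all: by end_near. Qed.

End germs.

(** * The limit process *)

(* The absolute value only makes this total: it is used at nonnegative rationals. *)
Definition rat_time (R : realType) (s : rat) : {nonneg R} := `|ratr s : R|%:nng.

Definition nat_time (R : realType) (N : nat) : {nonneg R} := N%:R%:nng.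

Definition rat_bit (R : realType) (j : rat * rat) (w : Dspace R) : bool :=
  ratr j.2 < coordinate (rat_time R j.1) w.

Definition rat_levels (q q' : rat) (s : rat) : seq (rat * rat) := [:: (s, q); (s, q')].

Fixpoint pair_bits (l : seq bool) : seq (bool * bool) :=
  if l is x :: y :: l' then (x, y) :: pair_bits l' else [::].

Lemma pair_bitsE (B : rat * rat -> bool) q q' (ss : seq rat) :
  pair_bits [seq B j | j <- flatten [seq rat_levels q q' s | s <- ss]] =
  [seq (B (s, q), B (s, q')) | s <- ss].
Proof. by elim: ss => //= s ss ->. Qed.

Lemma measurable_rat_bit (R : realType) j :
  measurable ([set w | rat_bit j w] : set (Dspace R)).
Proof. by apply: measurable_superlevel; exact: measurable_coordinate. Qed.

Section rational_crossings.
Context {R : realType} (P : probability (Dspace R) R) (V : {nonneg R} -> R).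
Hypothesis qP : quasimartingale P V.
Let bits q q' ss w := [seq (rat_bit (R := R) (s, q) w, rat_bit (s, q') w) | s <- ss].

Let rat_path (N : nat) (s : rat) (ss : seq rat) : sorted <%R (s :: ss) ->
    (forall r, r \in s :: ss -> 0 <= r <= N%:R) ->
  path (fun s t : {nonneg R} => s%:num <= t%:num) (rat_time R s) (map (rat_time R) ss) /\
  (last (rat_time R s) (map (rat_time R) ss))%:num <= N%:R :> R.
Proof.
move=> srt h; split.
  elim: ss s srt h => //= r ss IH s /andP[sr pr] h.
  rewrite IH//; last by move=> x xr; apply: h; rewrite inE xr orbT.
  have /andP[s0 _] := h s (mem_head _ _).
  rewrite andbT !ger0_norm ?ler_rat ?ler0q ?(ltW sr)//.
  by rewrite (le_trans s0 (ltW sr)).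
rewrite last_map /=; have /andP[h1 h2] := h _ (mem_last s ss).
by rewrite ger0_norm ?ler0q// -(ratr_nat R) ler_rat.
Qed.

Lemma rat_crossing_probability (N : nat) v0 m (q q' : rat) (ss : seq rat) : q < q' ->
  (v0 <= 1)%N -> (0 < m)%N -> sorted <%R ss ->
  (forall s, s \in ss -> 0 <= s <= N%:R) ->
  (ratr q' - ratr q) * m%:R *
    fine (P [set w | (m.*2 <= phase v0 (bits q q' ss w))%N]) <=
  3 * energy P V (nat_time R N) + 2 * `|ratr q|.
Proof.
move=> qq' v01 m0 srt ssN.
case: ss srt ssN => [|s ss] srt ssN.
  rewrite (_ : [set w | _] = set0); last first.
    apply/seteqP; split => // w /=; rewrite leqNgt; case/negP.
    by apply: leq_ltn_trans v01 _; rewrite -addnn -{1}(prednK m0) addSn ltnS; lia.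
  rewrite measure0 mulr0 addr_ge0// mulr_ge0//.
  apply: le_trans (Rintegral_norm_le_energy qP _).
  exact: Rintegral_ge0.
have [h1 h2] := rat_path srt ssN.
have := @crossing_probability_le R P V qP (ratr q) (ratr q') v0 m _ _ (nat_time R N) _ v01 h1 h2.
rewrite -map_cons ltr_rat => /(_ qq'); apply: le_trans.
rewrite le_eqVlt; apply/orP; left; apply/eqP; congr (_ * fine (P _)).
by apply/seteqP; split => w /=; rewrite -map_comp.
Qed.

Lemma rat_excursion_probability (N K : nat) (ss : seq rat) : (0 < K)%N ->
  sorted <%R ss -> (forall s, s \in ss -> 0 <= s <= N%:R) ->
  K%:R * fine (P [set w | (1 <= phase 0 (bits (- K%:R) 0 ss w))%N]) <=
  3 * energy P V (nat_time R N).
Proof.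
move=> K0 srt ssN.
case: ss srt ssN => [|s ss] srt ssN.
  rewrite (_ : [set w | _] = set0); last by apply/seteqP; split.
  rewrite measure0 mulr0 mulr_ge0//.
  apply: le_trans (Rintegral_norm_le_energy qP _).
  exact: Rintegral_ge0.
have [h1 h2] := rat_path srt ssN.
have := @lower_excursion_probability_le R P V qP K%:R _ _ (nat_time R N) _ h1 h2.
rewrite -map_cons ltr0n => /(_ K0); apply: le_trans.
rewrite le_eqVlt; apply/orP; left; apply/eqP; congr (_ * fine (P _)).
apply/seteqP; split => w /=; rewrite -map_comp /bits /level_bits /rat_bit /=;
  by rewrite rmorphN/= ratr_nat rmorph0.
Qed.

End rational_crossings.

Lemma Rintegral_bool d (T : measurableType d) (R : realType)
    (P : probability T R) (B : T -> bool) : measurable [set x | B x] ->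
  \int[P]_x (B x)%:R = fine (P [set x | B x]).
Proof.
move=> mB; rewrite /Rintegral (eq_integral (fun x => (\1_[set x | B x] x)%:E)).
  by rewrite integral_indic// setIT.
move=> x _; rewrite indicE; congr ((nat_of_bool _)%:R%:E).
by apply/idP/idP => [h|/set_mem//]; exact: mem_set.
Qed.

Lemma negligible_of_vanishing_bounds d (T : measurableType d) (R : realType)
    (mu : probability T R) (S : set T) (B : nat -> set T) (C : R) :
  (forall m, measurable (B m)) -> (forall m, S `<=` B m) ->
  (forall m, m.+1%:R * fine (mu (B m)) <= C) -> mu.-negligible S.
Proof.
move=> mB SB BC; exists (\bigcap_m B m); split.
- by apply: bigcap_measurable => //; exists 0%N.
- apply/eqP; rewrite eq_le measure_ge0 andbT; apply/lee_addgt0Pr => e e0.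
  have C0 : 0 <= C by apply: le_trans (BC 0%N); rewrite mulr_ge0// fine_ge0.
  have [m Cm] : exists m : nat, C / e <= m.+1%:R.
    by exists (Num.trunc (C / e)); apply/ltW/truncnS_gt.
  rewrite add0e; apply: (@le_trans _ _ (mu (B m))).
    apply: le_measure; rewrite ?inE//; last exact: bigcap_inf.
    by apply: bigcap_measurable => //; exists 0%N.
  rewrite -(fineK (fin_num_measure mu _ (mB m))) lee_fin.
  rewrite -(ler_pM2l (ltr0Sn R m)); apply: le_trans (BC m) _.
  by rewrite -ler_pdivrMr.
- by move=> x Sx m _; exact: SB.
Qed.

Lemma negligible_bigcup_countType d (T : measurableType d) (R : realType)
    (mu : {measure set T -> \bar R}) (I : countType) (A : I -> set T) :
  (forall i, mu.-negligible (A i)) -> mu.-negligible (\bigcup_i A i).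
Proof.
move=> nA.
apply: (@negligibleS _ _ _ _ (\bigcup_n
    (if @unpickle I n is Some i then A i else set0))).
  by move=> x [i _ Aix]; exists (pickle i) => //; rewrite pickleK.
apply: negligible_bigcup => n; case: (unpickle n) => [i|]//.
exact: negligible_set0.
Qed.

Definition rational_times_upto (N : nat) (ss : seq rat) : Prop :=
  sorted <%R ss /\ forall s, s \in ss -> 0 <= s <= N%:R.

(** Increasing finite sets that exhaust the rationals of [0, N]: a crossing along some finite set of
    times becomes an increasing countable union of events. *)
Definition rational_grid (N j : nat) : seq rat :=
  sort <=%R (undup [seq s <- pmap (@unpickle rat) (iota 0 j) | 0 <= s <= N%:R]).

Lemma rational_grid_upto N j : rational_times_upto N (rational_grid N j).
Proof.
split; last by move=> s; rewrite mem_sort mem_undup mem_filter => /andP[].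
rewrite lt_sorted_uniq_le sort_uniq undup_uniq/=.
by apply: sort_sorted; exact: le_total.
Qed.

Lemma rational_times_subseq N j ss ss' :
  rational_times_upto N ss -> rational_times_upto j ss' ->
  {subset ss <= ss'} -> subseq ss ss'.
Proof.
move=> [s1 _] [s2 _] sub.
rewrite (_ : ss = [seq x <- ss' | x \in ss]); first exact: filter_subseq.
apply: lt_sorted_eq => //; first by apply: sorted_filter => //; exact: lt_trans.
move=> x; rewrite mem_filter; apply/idP/andP => [xs|[]//].
by split => //; exact: sub.
Qed.

Lemma rational_grid_mono N i j : (i <= j)%N ->
  {subset rational_grid N i <= rational_grid N j}.
Proof.
move=> ij s; rewrite !mem_sort !mem_undup !mem_filter => /andP[-> /=].
rewrite !mem_pmap => /mapP[n]; rewrite mem_iota => /andP[_ ni] E.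
by apply/mapP; exists n => //; rewrite mem_iota (leq_trans ni).
Qed.

Lemma rational_grid_exhausts N ss : rational_times_upto N ss ->
  exists j, {subset ss <= rational_grid N j}.
Proof.
move=> [_ ssN]; exists (\max_(s <- ss) (pickle s).+1)%N => s sss.
rewrite mem_sort mem_undup mem_filter ssN//= mem_pmap; apply/mapP.
exists (pickle s); last by rewrite pickleK.
by rewrite mem_iota /= (big_rem s sss)/= leq_max leqnn.
Qed.

Section limit_code.
Context {R : realType} (P : nat -> probability (Dspace R) R)
  (V : nat -> {nonneg R} -> R).
Hypothesis qP : forall n, quasimartingale (P n) (V n).
Hypothesis energy_bounded : forall N : nat, exists C : R, forall n,
  energy (P n) (V n) (nat_time R N) <= C.
Context d (Om : measurableType d) (mu : probability Om R)
  (c : rat * rat -> Om -> bool).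
Hypothesis mc : forall j, measurable [set u | c j u].
Hypothesis c_lim : forall (js : seq (rat * rat)) (F : seq bool -> R),
  \int[P n]_w F [seq rat_bit j w | j <- js] @[n --> \oo] -->
  \int[mu]_u F [seq c j u | j <- js].

Lemma limit_event_le (js : seq (rat * rat)) (E : pred (seq bool)) (C : R) :
  (forall n, fine (P n [set w | E [seq rat_bit j w | j <- js]]) <= C) ->
  fine (mu [set u | E [seq c j u | j <- js]]) <= C.
Proof.
move=> PC; rewrite -Rintegral_bool; last first.
  exact: (discrete_measurable_seq js mc E).
have h := @c_lim js (fun l => (E l)%:R).
have := cvgr_to_le h (b := C).
apply; apply: nearW => n.
rewrite Rintegral_bool//.
exact: (discrete_measurable_seq js (@measurable_rat_bit R) E).
Qed.

Let bits q q' (ss : seq rat) u := [seq (c (s, q) u, c (s, q') u) | s <- ss].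

Lemma limit_bits_event_le q q' (ss : seq rat) (E : pred (seq (bool * bool))) (C : R) :
  (forall n, fine (P n [set w |
     E [seq (rat_bit (s, q) w, rat_bit (s, q') w) | s <- ss]]) <= C) ->
  fine (mu [set u | E (bits q q' ss u)]) <= C.
Proof.
move=> PC.
pose js := flatten [seq rat_levels q q' s | s <- ss].
rewrite (_ : [set u | _] = [set u | (E \o pair_bits) [seq c j u | j <- js]]); last first.
  by apply/seteqP; split => u /=; rewrite (pair_bitsE (c^~ u)).
apply: limit_event_le => n; apply: le_trans (PC n).
rewrite le_eqVlt; apply/orP; left; apply/eqP; congr (fine (P n _)).
by apply/seteqP; split => w /=; rewrite (pair_bitsE ((@rat_bit R)^~ w)).
Qed.

Lemma measurable_bits_event q q' ss (E : pred (seq (bool * bool))) :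
  measurable [set u | E (bits q q' ss u)].
Proof.
rewrite (_ : [set u | _] = [set u |
    (E \o pair_bits) [seq c j u | j <- flatten [seq rat_levels q q' s | s <- ss]]]).
  exact: (discrete_measurable_seq _ mc (E \o pair_bits)).
by apply/seteqP; split => u /=; rewrite (pair_bitsE (c^~ u)).
Qed.

Let crossing N v m q q' :=
  [set u | exists2 ss, rational_times_upto N ss & (m <= phase v (bits q q' ss u))%N].

Let crossingE N v m q q' : crossing N v m q q' =
  \bigcup_j [set u | (m <= phase v (bits q q' (rational_grid N j) u))%N].
Proof.
apply/seteqP; split => u /=; last first.
  by move=> [j _ h]; exists (rational_grid N j) => //; exact: rational_grid_upto.
move=> [ss ssN h]; have [j sj] := rational_grid_exhausts ssN.
exists j => //=; apply: leq_trans h _; apply: phase_subseq => //.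
by apply: map_subseq; apply: rational_times_subseq ssN (rational_grid_upto N j) sj.
Qed.

Let measurable_crossing N v m q q' : measurable (crossing N v m q q').
Proof.
rewrite crossingE; apply: bigcup_measurable => j _.
exact: (measurable_bits_event q q' _ (fun l => (m <= phase v l)%N)).
Qed.

(** A bound uniform in [n] and in the set of times passes to the limit in [n] on each grid, then to
    the union over the grids by continuity from below. *)
Let crossing_le N v m q q' (C : R) :
  (forall n ss, rational_times_upto N ss -> fine (P n [set w |
     (m <= phase v [seq (rat_bit (s, q) w, rat_bit (s, q') w) | s <- ss])%N]) <= C) ->
  fine (mu (crossing N v m q q')) <= C.
Proof.
move=> PC; rewrite crossingE.
set F := fun j => _.
have mF j : measurable (F j).
  exact: (measurable_bits_event q q' _ (fun l => (m <= phase v l)%N)).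
have ndF : nondecreasing_seq F.
  move=> i j ij; apply/subsetPset => u /= h; apply: leq_trans h _.
  apply: phase_subseq => //; apply: map_subseq.
  by apply: rational_times_subseq (rational_grid_mono ij); exact: rational_grid_upto.
have mU : measurable (\bigcup_j F j) by exact: bigcup_measurable.
have FU := nondecreasing_cvg_mu (mu := mu) mF mU ndF.
rewrite -lee_fin fineK ?fin_num_measure//.
rewrite -(cvg_lim _ FU)//; apply: lime_le; first by apply/cvg_ex; eexists; exact: FU.
apply: nearW => j /=; rewrite -[X in (X <= _)%E]fineK ?fin_num_measure// lee_fin.
apply: (@limit_bits_event_le _ _ _ (fun l => (m <= phase v l)%N)) => n.
by apply: PC; exact: rational_grid_upto.
Qed.

Lemma negligible_many_crossings (N : nat) (q q' : rat) : q < q' ->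
  mu.-negligible (\bigcap_m crossing N 0 m q q').
Proof.
move=> qq'; have [C PC] := energy_bounded N.
have D0 : 0 < ratr q' - ratr q :> R by rewrite subr_gt0 ltr_rat.
apply: (@negligible_of_vanishing_bounds _ _ _ _ _ (fun m => crossing N 0 (m.+1.*2) q q')
   ((3 * C + 2 * `|ratr q|) / (ratr q' - ratr q))) => //.
  by move=> m u; exact.
move=> m; rewrite -ler_pdivlMl//; apply: crossing_le => n ss [s1 s2].
rewrite ler_pdivlMl// ler_pdivlMr// mulrC mulrA.
apply: le_trans (rat_crossing_probability (qP n) qq' _ _ s1 s2) _ => //.
by rewrite lerD2r ler_pM2l.
Qed.

Let crossing_single N v m q q' s u : 0 <= s <= N%:R ->
  (m <= phase v (bits q q' [:: s] u))%N -> crossing N v m q q' u.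
Proof.
by move=> sN h; exists [:: s] => //; split => // r; rewrite inE => /eqP->.
Qed.

Lemma negligible_unbounded (N : nat) : mu.-negligible
  [set u | forall K : nat, exists2 s, 0 <= s <= N%:R & ~~ (c (s, - K%:R) u && ~~ c (s, K%:R) u)].
Proof.
have [C PC] := energy_bounded N.
(* A passage above m + 1 is a sale by a strategy that starts with a unit (phase from 1 to 2); a
   passage to -(m + 1) or below is a purchase (phase from 0 to 1). Each has probability at most 3 C
   / (m + 1), hence [6 * C]. *)
pose B (m : nat) := crossing N 1 2 0 m.+1%:R `|` crossing N 0 1 (- m.+1%:R) 0.
apply: (@negligible_of_vanishing_bounds _ _ _ _ _ B (6 * C)) => //.
- by move=> m; exact: measurableU.
- move=> m u /(_ m.+1)[s sN]; rewrite negb_and negbK => h.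
  have [cs|cs] := boolP (c (s, m.+1%:R) u).
    left; apply: (crossing_single sN); rewrite /= cs /phase_step /=.
    by rewrite addn1.
  move: h; rewrite (negbTE cs) orbF => cs'.
  by right; apply: (crossing_single sN); rewrite /= /phase_step /= cs'.
- move=> m; apply: (@le_trans _ _ (m.+1%:R * (fine (mu (crossing N 1 2 0 m.+1%:R)) +
    fine (mu (crossing N 0 1 (- m.+1%:R) 0))))).
    rewrite ler_pM2l// -lee_fin EFinD !fineK ?fin_num_measure//; last exact: measurableU.
    exact: measureU2.
  have -> : 6 * C = 3 * C + 3 * C by ring.
  rewrite mulrDr; apply: lerD; rewrite -ler_pdivlMl//; apply: crossing_le => n ss [s1 s2].
    rewrite ler_pdivlMl//.
    have m0 : 0 < m.+1%:R :> rat by [].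
    have := rat_crossing_probability (qP n) m0 (leqnn 1) (ltn0Sn 0) s1 s2.
    rewrite rmorph0 subr0 normr0 mulr0 addr0 mulr1 ratr_nat => h.
    by apply: le_trans h _; rewrite ler_pM2l.
  rewrite ler_pdivlMl//.
  apply: le_trans (rat_excursion_probability (qP n) (ltn0Sn m) s1 s2) _.
  by rewrite ler_pM2l.
Qed.

Lemma negligible_not_mono (s q q' : rat) : q <= q' ->
  mu.-negligible [set u | c (s, q') u && ~~ c (s, q) u].
Proof.
move=> qq'.
pose E l := (head (true, false) l).2 && ~~ (head (true, false) l).1.
have := @limit_bits_event_le q q' [:: s] E 0.
have m := @measurable_bits_event q q' [:: s] E.
rewrite /= in m * => h; exists [set u | c (s, q') u && ~~ c (s, q) u]; split => //.
apply/eqP; rewrite eq_le measure_ge0 andbT -[X in (X <= _)%E]fineK ?fin_num_measure//.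
rewrite lee_fin; apply: h => n.
rewrite (_ : [set w | _] = set0) ?measure0//; apply/seteqP; split => // w /=.
rewrite /rat_bit /= => /andP[h /negP]; apply.
by apply: le_lt_trans h; rewrite ler_rat.
Qed.

Lemma ae_regular_code :
  {ae mu, forall u, regular_code (fun s q => c (s, q) u)}.
Proof.
have n1 : mu.-negligible (\bigcup_(j : rat * (rat * rat))
    [set u | (j.2.1 <= j.2.2) && (c (j.1, j.2.2) u && ~~ c (j.1, j.2.1) u)]).
  apply: negligible_bigcup_countType => -[s [q q']] /=.
  case: (leP q q') => [/(negligible_not_mono s)//|_].
  by rewrite (_ : [set u | _] = set0); [exact: negligible_set0|apply/seteqP; split].
have n2 : mu.-negligible (\bigcup_(j : nat * (rat * rat))
    [set u | j.2.1 < j.2.2 /\ (\bigcap_m crossing j.1 0 m j.2.1 j.2.2) u]).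
  apply: negligible_bigcup_countType => -[N [q q']] /=.
  case: (ltP q q') => [qq'|_].
    by apply: negligibleS (negligible_many_crossings N qq') => u [].
  by rewrite (_ : [set u | _] = set0); [exact: negligible_set0|apply/seteqP; split => // u []].
have n3 := negligible_bigcup_countType negligible_unbounded.
apply: negligibleS (negligibleU (negligibleU n1 n2) n3) => u /= nr.
apply: contrapT => /not_orP[/not_orP[h1 h2] h3]; apply: nr; split.
- move=> s q q' qq' h; apply/negPn/negP => h'; apply: h1.
  by exists (s, (q, q')) => //=; rewrite qq' h h'.
- move=> N q q' qq'; apply: contrapT => h; apply: h2.
  exists (N, (q, q')) => //=; split => // m _.
  apply: contrapT => h'; apply: h; exists m => ss s1 s2.
  by rewrite ltnNge; apply/negP => h; apply: h'; exists ss.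
- move=> N; apply: contrapT => h; apply: h3; exists N => //= K.
  apply: contrapT => h'; apply: h; exists K => s sN.
  by apply: contrapT => h; apply: h'; exists s => //; apply/negP.
Qed.

End limit_code.

(** * Convergence at real times *)

Section row_functions.
Context {R : realType} (d : nat).
Implicit Types (x y : 'rV[R]_d) (f : 'rV[R]_d -> R).

Lemma row_ballP x y e : 0 < e ->
  (forall i, `|x ord0 i - y ord0 i| < e) -> ball x e y.
Proof. by move=> e0 h; split => // i j; rewrite ord1; exact: h. Qed.

Lemma row_continuous_near f x e : continuous f -> 0 < e ->
  exists2 r, 0 < r & forall y, (forall i, `|x ord0 i - y ord0 i| < r) ->
    `|f x - f y| < e.
Proof.
move=> cf e0; have /cvgrPdist_lt/(_ e e0)/nbhs_ballP[r /= r0 rf] := cf x.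
by exists r => // y xy; apply: rf; exact: row_ballP.
Qed.

(** Only [x] is confined to the box: below, [y] is an approximation that may leave it. Around each
    point of the box, half the radius of continuity works as a modulus, and compactness makes this
    uniform. *)
Lemma uniformly_continuous_box f (K e : R) : continuous f -> 0 < e ->
  exists2 r, 0 < r & forall x y, (forall i, `|x ord0 i| <= K) ->
    (forall i, `|x ord0 i - y ord0 i| < r) -> `|f x - f y| < e.
Proof.
move=> cf e0.
have /compact_near_coveringP/(_ R (0^'+)
    (fun r x => forall y, (forall i, `|x ord0 i - y ord0 i| < r) -> `|f x - f y| < e)) :=
  @rV_compact R d (fun _ => `[- K, K]%classic) (fun _ => @segment_compact R _ _).
case.
  move=> x _; have [r r0 rf] := row_continuous_near x cf (divr_gt0 e0 (ltr0n R 2)).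
  have r20 : 0 < r / 2 by rewrite divr_gt0.
  exists (ball x (r / 2), [set s | s < r / 2]).
    by split => /=; [exact: nbhsx_ballx|exact: nbhs_right_lt].
  move=> [x' s] /= [[_ xx'] sr] y x'y.
  have fx' : `|f x - f x'| < e / 2.
    by apply: rf => i; apply: lt_trans (xx' ord0 i) _; rewrite ltr_pdivrMr// ltr_pMr// ltr1n.
  have fy : `|f x - f y| < e / 2.
    apply: rf => i; rewrite -(subrKA (x' ord0 i)) (splitr r).
    apply: le_lt_trans (ler_normD _ _) (ltrD (xx' ord0 i) _).
    exact: lt_trans (x'y i) sr.
  rewrite -(subrKA (f x)) (splitr e); apply: le_lt_trans (ler_normD _ _) (ltrD _ fy).
  by rewrite distrC.
move=> r0 /= r0P hr.
have r02 : 0 < r0 / 2 by rewrite divr_gt0.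
have := hr (r0 / 2); rewrite /ball_ /= sub0r normrN gtr0_norm//.
move=> /(_ _ r02) h; exists (r0 / 2) => // x y xK xy.
apply: h => //; first by rewrite ltr_pdivrMr// ltr_pMr// ltr1n.
by move=> i; rewrite /= in_itv/= -ler_norml.
Qed.

End row_functions.

Definition local_to (J : eqType) (D : Type) (js : seq J) (F : (J -> bool) -> D) :=
  forall B B', {in js, B =1 B'} -> F B = F B'.

Lemma local_to_seq (J : eqType) (D : Type) (js : seq J) (F : (J -> bool) -> D) :
  local_to js F -> exists G : seq bool -> D, forall B, F B = G [seq B j | j <- js].
Proof.
move=> Fjs; exists (fun l => F (fun j => nth false l (index j js))) => B.
by apply: Fjs => j jjs; rewrite (nth_map j) ?index_mem// nth_index.
Qed.

Lemma discrete_measurable_local dT (T : measurableType dT) (J : eqType) (D : Type)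
    (js : seq J) (F : (J -> bool) -> D) (B : J -> T -> bool) :
  (forall j, measurable [set w | B j w]) -> local_to js F ->
  discrete_measurable (fun w => F (B^~ w)).
Proof.
move=> mB /local_to_seq[G FG] Y.
rewrite (_ : _ @^-1` Y = (fun w => [seq B j w | j <- js]) @^-1` (G @^-1` Y)).
  exact: discrete_measurable_seq.
by apply/seteqP; split => w /=; rewrite -(FG (B^~ w)).
Qed.

Section step.
Context {R : realType}.
Implicit Types B : rat -> bool.

(** For j < 2 m (m + 1) these levels have mesh 1 / (m + 1) and fill [-m, m[: one parameter both
    refines the levels and widens their range. *)
Definition grid_level (m j : nat) : rat := - m%:R + j%:R / m.+1%:R.

(* Approximates, from the comparisons with the finitely many levels of a grid of
   [-m, m], the real number y such that B q <-> q < y. *)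
Definition step (m : nat) B : R :=
  \big[Num.max/- m%:R]_(j < (2 * m * m.+1)%N | B (grid_level m j))
    ratr (grid_level m j).

Lemma step_le m B (z : R) : - m%:R <= z ->
  (forall q, z <= ratr q -> ~~ B q) -> step m B <= z.
Proof.
move=> mz Bz; apply: bigmax_le => // j Bj.
by rewrite leNgt; apply: contraL Bj => /ltW; exact: Bz.
Qed.

Lemma step_ge m B (y : R) : y <= m%:R ->
  (forall q, ratr q < y -> B q) -> y - m.+1%:R^-1 <= step m B.
Proof.
move=> ym By; have [ym'|my] := leP y (- m%:R).
  apply: (@le_trans _ _ (- m%:R)); last exact: bigmax_ge_id.
  by rewrite lerBlDr (le_trans ym')// lerDl.
have p0 : 0 < (y + m%:R) * m.+1%:R by rewrite mulr_gt0// -ltrBlDr sub0r.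
(* [j] numbers the last level of the mesh strictly below [y]. *)
have [j jy yj] : exists2 j : nat, j%:R < (y + m%:R) * m.+1%:R & (y + m%:R) * m.+1%:R <= j%:R + 1.
  have ex : exists n : nat, (y + m%:R) * m.+1%:R <= n%:R.
    by exists (Num.trunc ((y + m%:R) * m.+1%:R)).+1; exact/ltW/truncnS_gt.
  case: (ex_minnP ex) => -[|j] jP jmin; first by move: p0; rewrite ltNge jP.
  exists j; last by rewrite natr1.
  by rewrite ltNge; apply/negP => /jmin; rewrite ltnn.
have jlt : (j < 2 * m * m.+1)%N.
  rewrite -(ltr_nat R); apply: lt_le_trans jy _.
  by rewrite natrM ler_pM2r// natrM mulr_natl mulr2n lerD2r.
have qE : ratr (grid_level m j) = - m%:R + j%:R / m.+1%:R :> R.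
  by rewrite /grid_level rmorphD rmorphN /= fmorph_div/= !ratr_nat.
have Bj : B (grid_level m j).
  by apply: By; rewrite qE addrC ltrBlDr ltr_pdivrMr.
apply: (@le_trans _ _ (ratr (grid_level m j))); last first.
  by rewrite /step (bigmaxD1 (Ordinal jlt))//= le_max lexx.
have : y + m%:R <= (j%:R + 1) / m.+1%:R by rewrite ler_pdivlMr.
rewrite qE mulrDl div1r -lerBrDr lerBlDr => /le_trans; apply.
by rewrite [leLHS]addrC addrA.
Qed.

Lemma step_dist m B (y : R) : `|y| <= m%:R ->
  (forall q, B q = (ratr q < y)) -> `|y - step m B| <= m.+1%:R^-1.
Proof.
rewrite ler_norml => /andP[h1 h2] By.
have s1 : y - m.+1%:R^-1 <= step m B by apply: step_ge => // q; rewrite By.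
have s2 : step m B <= y by apply: step_le => // q; rewrite By leNgt.
by rewrite ger0_norm ?subr_ge0// lerBlDl -lerBlDr.
Qed.

Lemma eq_step m B B' :
  (forall j, (j < 2 * m * m.+1)%N -> B (grid_level m j) = B' (grid_level m j)) ->
  step m B = step m B'.
Proof. by move=> BB'; apply: eq_bigl => j; exact: BB'. Qed.

Lemma step_local m :
  local_to [seq grid_level m j | j <- iota 0 (2 * m * m.+1)] (step m).
Proof.
move=> B B' BB'; apply: eq_step => j jm; apply: BB'; apply: map_f.
by rewrite mem_iota.
Qed.

Lemma measurable_step dT (T : measurableType dT) m (B : T -> rat -> bool) :
  (forall q, measurable [set w | B w q]) ->
  measurable_fun setT (fun w => step m (B w)).
Proof.
move=> mB _ Y _; rewrite setTI.
by apply: (discrete_measurable_local (B := fun q w => B w q) mB (@step_local m)).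
Qed.

Lemma inv_nat_lt (e : R) : 0 < e -> exists m : nat, forall n, (m <= n)%N -> n.+1%:R^-1 < e.
Proof.
move=> e0; exists (Num.trunc e^-1) => n mn.
rewrite invf_plt ?posrE//; apply: lt_le_trans (truncnS_gt _) _.
by rewrite ler_nat ltnS.
Qed.

(** The bits may change with [m]: it suffices that each rational level is eventually decided, since
    two levels close to [y] then confine the step by monotonicity. This covers the bits of one fixed
    value and bits at times approaching t from the right. *)
Lemma step_cvg (B_ : nat -> rat -> bool) (y : R) :
  (forall m q q', q <= q' -> B_ m q' -> B_ m q) ->
  (forall q, ratr q < y -> \forall m \near \oo, B_ m q) ->
  (forall q, y < ratr q -> \forall m \near \oo, ~~ B_ m q) ->
  step m (B_ m) @[m --> \oo] --> y.
Proof.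
move=> Bmono Blt Bgt; apply/cvgrPdist_le => e e0.
have e20 : 0 < e / 2 by rewrite divr_gt0.
have [q1] := @rat_in_itvoo R (y - e / 2) y ltac:(lra).
have [q2] := @rat_in_itvoo R y (y + e / 2) ltac:(lra).
rewrite !in_itv/= => /andP[q21 q22] /andP[q11 q12].
have [m1 m1P] := inv_nat_lt e20.
pose M := (Num.trunc `|ratr q1 : R|).+1 + (Num.trunc `|ratr q2 : R|).+1.
have n1 := Blt _ q12; have n2 := Bgt _ q21.
near=> m.
have Mm : (M <= m)%N by near: m; exact: nbhs_infty_ge.
have q1m : `|ratr q1 : R| <= m%:R.
  by apply: le_trans (ltW (truncnS_gt _)) _; rewrite ler_nat (leq_trans (leq_addr _ _) Mm).
have q2m : `|ratr q2 : R| <= m%:R.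
  by apply: le_trans (ltW (truncnS_gt _)) _; rewrite ler_nat (leq_trans (leq_addl _ _) Mm).
have B1 : B_ m q1 by near: m.
have B2 : ~~ B_ m q2 by near: m.
have s1 : ratr q1 - m.+1%:R^-1 <= step m (B_ m).
  apply: step_ge; first exact: le_trans (ler_norm _) q1m.
  by move=> q; rewrite ltr_rat => /ltW h; exact: Bmono h B1.
have s2 : step m (B_ m) <= ratr q2.
  apply: step_le; first by move: q2m; rewrite ler_norml => /andP[].
  by move=> q; rewrite ler_rat => h; apply: contra B2; exact: Bmono.
have m1m : m.+1%:R^-1 < e / 2 by apply: m1P; near: m; exact: nbhs_infty_ge.
by move: (m.+1%:R^-1 : R) s1 m1m => u s1 m1m; rewrite ler_distl; apply/andP; split; lra.
Unshelve. all: by end_near. Qed.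

End step.

Section measurable_row_functions.
Context {R : realType} (d : nat).

Lemma row_cvg (f : 'rV[R]_d -> R) (x_ : nat -> 'I_d -> R) (x : 'I_d -> R) :
  continuous f -> (forall i, x_ m i @[m --> \oo] --> x i) ->
  f (\row_i x_ m i) @[m --> \oo] --> f (\row_i x i).
Proof.
move=> cf xc; apply/cvgrPdist_lt => e e0.
have [r r0 rf] := row_continuous_near (\row_i x i) cf e0.
have h : \forall m \near \oo, forall i, `|x i - x_ m i| < r.
  apply: filter_forall => i.
  by have /cvgrPdist_lt/(_ r r0) := xc i.
by apply: filterS h => m h; apply: rf => i; rewrite !mxE.
Qed.

Lemma row_step_local (I : eqType) (h : 'I_d -> I) (D : Type)
    (f : 'rV[R]_d -> D) (m : nat) :
  local_to [seq (h i, grid_level m j) | i <- enum 'I_d, j <- iota 0 (2 * m * m.+1)]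
    (fun b => f (\row_i step m (fun q => b (h i, q)))).
Proof.
move=> b b' bb'; congr f; apply/rowP => i; rewrite !mxE.
apply: eq_step => j jm; apply: bb'; apply/allpairsP; exists (i, j) => /=.
by rewrite mem_enum mem_iota.
Qed.

(** The function is a pointwise limit of functions of finitely many bits, so no sigma-algebra on row
    vectors is involved. *)
Lemma measurable_row_fun dT (T : measurableType dT) (f : 'rV[R]_d -> R)
    (X : 'I_d -> T -> R) :
  continuous f -> (forall i, measurable_fun setT (X i)) ->
  measurable_fun setT (fun w => f (\row_i X i w)).
Proof.
move=> cf mX.
pose B (j : 'I_d * rat) w := ratr j.2 < X j.1 w.
have mB j : measurable [set w | B j w] by exact: measurable_superlevel.
apply: (@measurable_fun_cvg _ _ _ _
  (fun m w => f (\row_i step m (fun q => B (i, q) w)))); last first.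
  move=> w _; apply: row_cvg => // i; apply: step_cvg.
  - by move=> m q q' qq'; rewrite /B/=; apply: le_lt_trans; rewrite ler_rat.
  - by move=> q h; exact: nearW.
  - by move=> q h; apply: nearW => m; rewrite /B -leNgt ltW.
move=> m _ Y _; rewrite setTI.
apply: (discrete_measurable_local
  (js := [seq (i, grid_level m j) | i <- enum 'I_d, j <- iota 0 (2 * m * m.+1)])
  (F := fun b => f (\row_i step m (fun q => b (i, q))))) => //.
exact: (@row_step_local _ id).
Qed.

End measurable_row_functions.

Lemma bigcup_rat_measurable d (T : measurableType d) (D : set rat) (F : rat -> set T) :
  (forall q, measurable (F q)) -> measurable (\bigcup_(q in D) F q).
Proof.
move=> mF; rewrite bigcup_mkcond; apply: bigcupT_measurable_rat => q.
by case: ifP.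
Qed.

Lemma bigcap_rat_measurable d (T : measurableType d) (D : set rat) (F : rat -> set T) :
  (forall q, measurable (F q)) -> measurable (\bigcap_(q in D) F q).
Proof.
move=> mF; rewrite -[X in measurable X]setCK setC_bigcap; apply: measurableC.
by apply: bigcup_rat_measurable => q; exact: measurableC.
Qed.

Lemma measurable_constant_set d (T : measurableType d) (A : Prop) :
  measurable [set _ : T | A].
Proof.
have [h|h] := pselect A.
  by rewrite (_ : [set _ | A] = setT)//; apply/seteqP; split.
by rewrite (_ : [set _ | A] = set0)//; apply/seteqP; split.
Qed.

Section limit_path.
Context {R : realType} d (Om : measurableType d) (mu : probability Om R)
  (c : rat * rat -> Om -> bool).
Hypothesis mc : forall j, measurable [set u | c j u].

Let code u s q := c (s, q) u.

Lemma measurable_right_germ (t : R) q :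
  measurable [set u | right_germ t [set s | c (s, q) u]].
Proof.
rewrite (_ : [set u | _] = \bigcup_n \bigcap_(s in [set s | t < ratr s < t + n.+1%:R^-1])
    [set u | c (s, q) u]).
  apply: bigcup_measurable => n _.
  exact: bigcap_rat_measurable.
apply/seteqP; split => u /=.
  move=> [e e0 h]; have [n ne] : exists n : nat, n.+1%:R^-1 < e.
    exists (Num.trunc e^-1).
    by rewrite invf_plt ?posrE//; exact: truncnS_gt.
  exists n => // s /= /andP[ts sn]; apply: h; rewrite ts /=.
  by apply: lt_trans sn _; rewrite ltrD2l.
by move=> [n _ h]; exists n.+1%:R^-1 => // s ts; exact: (h s ts).
Qed.

Lemma limit_path :
  {ae mu, forall u, regular_code (code u)} ->
  exists2 Psi : Om -> Dspace R, measurable_fun setT Psi &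
    {ae mu, forall u, right_values (code u) (fun t => coordinate t (Psi u))}.
Proof.
move=> [N [mN N0 regN]].
have reg u : ~ N u -> regular_code (code u).
  by move=> Nu; apply: contrapT => h; apply: Nu; exact: regN.
(* On the null set [N] the zero path is chosen, which makes [Psi] total and keeps it measurable. *)
have /choice[Psi PsiP] : forall u, exists w : cadlag_path R,
    (N u -> w = point) /\ (~ N u -> right_values (code u) (fun t => coordinate t w)).
  move=> u; have [Nu|Nu] := pselect (N u); first by exists point.
  have [y cy vy] := @regular_code_cadlag R _ (reg u Nu).
  by exists (CadlagPath cy).
exists (Psi : Om -> Dspace R); last first.
  exists N; split => // u; apply: contra_notP => Nu.
  exact: (PsiP u).2.
apply: (@measurability _ _ Om (Dspace R) setT Psi (coord_events setT)) => //.
move=> _ [_ [t _ [B mB <-]] <-].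
have mPt : measurable_fun setT (fun u => coordinate t (Psi u)).
  apply: (@measurability _ _ Om (measurableTypeR R) setT _ (@RGenOInfty.G R)).
    exact: RGenOInfty.measurableE.
  move=> _ [_ [a ->] <-].
  (* Off [N], the value exceeds [a] exactly when, for some rational q > a, the bits of level q are
     true just after [t]. *)
  rewrite setTI (_ : _ @^-1` _ =
    (N `&` [set _ | a < coordinate t (point : cadlag_path R)]) `|` (~` N `&`
      \bigcup_(q in [set q : rat | a < ratr q])
        [set u | right_germ t%:num [set s | c (s, q) u]])).
    apply: measurableU; apply: measurableI => //; first exact: measurable_constant_set.
      exact: measurableC.
    by apply: bigcup_rat_measurable => q; exact: measurable_right_germ.
  apply/seteqP; split => u /=; rewrite in_itv/= andbT.
    move=> aPu; have [Nu|Nu] := pselect (N u).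
      by left; split => //; move: aPu; rewrite ((PsiP u).1 Nu).
    right; split => //; have [q] := rat_in_itvoo aPu.
    rewrite in_itv/= => /andP[aq qP]; exists q => //=.
    exact: ((PsiP u).2 Nu t q).1.
  move=> [[Nu]|[Nu [q /= aq qg]]]; first by rewrite ((PsiP u).1 Nu).
  apply: lt_le_trans aq _; have [c1 _ _] := reg u Nu.
  exact: (right_values_ge c1 ((PsiP u).2 Nu)).
rewrite setTI (_ : _ @^-1` _ = (fun u => coordinate t (Psi u)) @^-1` B); last first.
  by apply/seteqP; split => u /=; [case|].
by rewrite -[X in measurable X]setTI; exact: mPt.
Qed.

Lemma pushforward_probability d' (T : measurableType d') (Psi : Om -> T) :
  measurable_fun setT Psi -> exists Q : probability T R,
    forall (g : T -> R) (C : R), measurable_fun setT g -> (forall x, `|g x| <= C) ->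
      \int[Q]_x g x = \int[mu]_u g (Psi u).
Proof.
move=> mPsi.
pose Psi' := MeasurableFun.Pack (MeasurableFun.Class (isMeasurableFun.Build _ _ _ _ _ mPsi)).
exists (distribution mu Psi') => g C mg gC.
rewrite /Rintegral /distribution integral_pushforward ?preimage_setT//.
  exact/measurable_EFinP.
apply: (@integrable_bounded _ _ _ _ (g \o Psi') C); first exact: measurableT_comp.
by move=> x; exact: gC.
Qed.

End limit_path.

(** For nondecreasing [g], the absence of a jump at [t], stated with rational arguments only. Time 0
    is excluded, as no time precedes it. *)
Definition continuity_time (R : realType) (g : rat -> R) (t : R) : Prop :=
  0 < t /\ forall e, 0 < e -> exists s s' : rat,
    [/\ 0 <= s, ratr s < t, t < ratr s' & g s' - g s < e].

(* The jumps of g at two such times are separated by a rational, so that each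
   of them can be labelled by a rational in its jump. *)
Lemma countable_discontinuity_times (R : realType) (g : rat -> R) :
  (forall s s', 0 <= s -> s <= s' -> g s <= g s') ->
  countable [set t | 0 <= t /\ ~ continuity_time g t].
Proof.
move=> g_mono; set D := [set t | _].
have jump t : exists q : rat, D t -> 0 < t ->
    (forall s : rat, 0 <= s -> ratr s < t -> g s < ratr q) /\
    (forall s' : rat, t < ratr s' -> ratr q < g s').
  have [[[t0 nt] tp]|h] := pselect (D t /\ 0 < t); last first.
    by exists 0 => Dt tp; exfalso; exact: h.
  have [e e0 he] : exists2 e, 0 < e & forall s s' : rat, 0 <= s -> ratr s < t ->
      t < ratr s' -> g s + e <= g s'.
    apply: contrapT => h; apply: nt; split => // e e0.
    apply: contrapT => h'; apply: h; exists e => // s s' s0 st ts'.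
    rewrite leNgt addrC -ltrBlDr; apply/negP => h; apply: h'.
    by exists s, s'; split => //; move: h; rewrite ltrBlDr addrC -ltrBlDr.
  pose S := g @` [set s | 0 <= s /\ ratr s < t].
  have S0 : S !=set0.
    by exists (g 0), 0 => //; split => //; rewrite rmorph0.
  have ubS s' : t < ratr s' -> ubound S (g s' - e).
    by move=> ts' _ [s [s0 st] <-]; rewrite lerBrDr; exact: he.
  have [s1] := @rat_in_itvoo R t (t + 1) ltac:(by rewrite ltrDl).
  rewrite in_itv/= => /andP[ts1 _].
  have supS : has_sup S by split => //; exists (g s1 - e); exact: ubS.
  have [q] := @rat_in_itvoo R (sup S) (sup S + e) ltac:(by rewrite ltrDl).
  rewrite in_itv/= => /andP[q1 q2]; exists q => _ _; split.
    move=> s s0 st; apply: le_lt_trans q1; apply: ub_le_sup; first exact: supS.2.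
    by exists s.
  move=> s' ts'; apply: lt_le_trans q2 _; rewrite -lerBrDr.
  exact: (ge_sup S0 (ubS s' ts')).
have /choice[q qP] := jump.
(* The number 0 is reserved for time 0, which has no jump label. *)
apply/countable_injP; exists (fun t => if t == 0 then 0%N else (pickle (q t)).+1).
have pos t : D t -> t != 0 -> 0 < t by case=> t0 _ tn0; rewrite lt_def tn0.
move=> t t'; rewrite !inE => Dt Dt'.
case: eqVneq => [->|/(pos _ Dt) tp]; case: eqVneq => [->|/(pos _ Dt') tp'] //.
move=> [/(pcan_inj pickleK) qq].
wlog : t t' Dt tp Dt' tp' qq / t < t'.
  move=> h; case: (ltgtP t t') => // tt'; first exact: h.
  by apply/esym; exact: h.
move=> tt'; have [s] := rat_in_itvoo tt'; rewrite in_itv/= => /andP[ts st'].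
have [_ h1] := qP t Dt tp; have [h2 _] := qP t' Dt' tp'.
have s0 : 0 <= s by rewrite -(ler0q R) ltW// (lt_trans tp).
have := lt_trans (h1 s ts) (h2 s s0 st').
by rewrite qq ltxx.
Qed.

Section proximity.
Context {R : realType} (P : probability (Dspace R) R) (V : {nonneg R} -> R).
Hypothesis qP : quasimartingale P V.
Context (d : nat) (f : 'rV[R]_d -> R) (B : R).
Hypotheses (f_cont : continuous f) (f_bound : forall x, `|f x| <= B).

Lemma bregman_large (K r x y : R) : 0 < K -> 0 < r -> `|x| <= K -> `|y| <= K ->
  r <= `|x - y| -> 1 <= 2 * (1 + K) ^+ 3 / r ^+ 2 * bregman x y.
Proof.
move=> K0 r0 xK yK rxy.
rewrite mulrAC ler_pdivlMr ?exprn_gt0// mul1r.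
have h1 : r ^+ 2 <= (x - y) ^+ 2.
  by rewrite -[leRHS]real_normK ?num_real// ler_sqr ?nnegrE// ltW.
apply: le_trans h1 _; apply: le_trans (bregman_bound x y) _.
rewrite mulrC ler_wpM2r ?bregman_ge0//.
have jx : jbracket x <= 1 + K by apply: le_trans (jbracket_le x) _; rewrite lerD2l.
have jy : jbracket y <= 1 + K by apply: le_trans (jbracket_le y) _; rewrite lerD2l.
have px := ltW (jbracket_gt0 x); have py := ltW (jbracket_gt0 y).
rewrite -mulrA ler_pM2l// [leRHS]exprSr; apply: ler_pM => //; first exact: sqr_ge0.
by rewrite lerXn2r// nnegrE (le_trans px).
Qed.

(* Either both vectors are in the box where f is uniformly continuous and they
   are close, or one of the terms of the sum is at least 1. *)
Lemma proximity_bound (e K r m : R) (x y z : 'I_d -> R) : 0 < K -> 0 < r -> 0 <= e ->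
  (forall v v' : 'rV[R]_d, (forall i, `|v ord0 i| <= K) ->
    (forall i, `|v ord0 i - v' ord0 i| < r) -> `|f v - f v'| < e) ->
  (forall i, `|z i| <= K -> `|z i - y i| < r / 2) ->
  `|f (\row_i x i) - f (\row_i y i)| <= e + 2 * B * \sum_i
    (`|x i| / K + `|z i| / K + 2 * (1 + K) ^+ 3 / (r / 2) ^+ 2 * bregman (x i) (z i)).
Proof.
move=> K0 r0 e0 fu zy; set S := \sum_i _.
have r20 : 0 < r / 2 by rewrite divr_gt0.
have B0 : 0 <= B by apply: le_trans (f_bound (\row_i x i)).
pose T i := `|x i| / K + `|z i| / K + 2 * (1 + K) ^+ 3 / (r / 2) ^+ 2 * bregman (x i) (z i).
have b0 i : 0 <= 2 * (1 + K) ^+ 3 / (r / 2) ^+ 2 * bregman (x i) (z i).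
  rewrite mulr_ge0 ?bregman_ge0// divr_ge0 ?sqr_ge0// mulr_ge0// exprn_ge0//.
  by rewrite addr_ge0// ltW.
have x0 i : 0 <= `|x i| / K by rewrite divr_ge0// ltW.
have z0 i : 0 <= `|z i| / K by rewrite divr_ge0// ltW.
have T0 i : 0 <= T i by rewrite !addr_ge0.
have S0 : 0 <= S by apply: sumr_ge0 => i _; exact: T0.
have [good|] := pselect (forall i, [/\ `|x i| <= K, `|z i| <= K & `|x i - z i| < r / 2]).
  apply: (@le_trans _ _ e); last by rewrite lerDl !mulr_ge0.
  apply/ltW/fu => i; rewrite !mxE; first by have [] := good i.
  have [_ zK xz] := good i; rewrite -(subrKA (z i)) (splitr r).
  exact: le_lt_trans (ler_normD _ _) (ltrD xz (zy i zK)).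
move=> /existsNP[i bad].
have Ti : 1 <= T i.
  have [xK|Kx] := leP `|x i| K; last first.
    by rewrite /T -addrA ler_wpDr ?addr_ge0// ler_pdivlMr// mul1r ltW.
  have [zK|Kz] := leP `|z i| K; last first.
    by rewrite /T ler_wpDr// ler_wpDl// ler_pdivlMr// mul1r ltW.
  rewrite /T ler_wpDl ?addr_ge0//; apply: bregman_large => //.
  by rewrite leNgt; apply/negP => h; apply: bad.
have S1 : 1 <= S.
  by rewrite /S (bigD1 i)//= ler_wpDr//; apply: sumr_ge0 => j _; exact: T0.
rewrite ler_wpDl//; apply: (@le_trans _ _ (2 * B)); last by rewrite ler_peMr// mulr_ge0.
by rewrite mulr_natl mulr2n; apply: le_trans (ler_normB _ _) (lerD _ _).
Qed.

(** In the mean of [proximity_bound], the absolute values and the divergence are replaced by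
    energies and energy increments. The law enters the bound only through its energy, which gives
    uniformity in n. *)
Lemma proximity_expectation (e K r : R) (m : nat) (t s : 'I_d -> {nonneg R}) :
  0 < K -> 0 < r -> 0 <= e -> K <= m%:R -> m.+1%:R^-1 < r / 2 ->
  (forall v v' : 'rV[R]_d, (forall i, `|v ord0 i| <= K) ->
    (forall i, `|v ord0 i - v' ord0 i| < r) -> `|f v - f v'| < e) ->
  (forall i, (t i)%:num <= (s i)%:num) ->
  `|\int[P]_w f (\row_i coordinate (t i) w) -
    \int[P]_w f (\row_i step m (fun q => ratr q < coordinate (s i) w))| <=
  e + 2 * B * \sum_i (energy P V (t i) / K + energy P V (s i) / K +
    2 * (1 + K) ^+ 3 / (r / 2) ^+ 2 * (energy P V (s i) - energy P V (t i))).
Proof.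
move=> K0 r0 e0 Km mr fu ts.
have [iX V0 _] := qP.
set k := 2 * (1 + K) ^+ 3 / (r / 2) ^+ 2.
have k0 : 0 <= k.
  rewrite divr_ge0 ?sqr_ge0// mulr_ge0// exprn_ge0//.
  by rewrite addr_ge0// ltW.
have B0 : 0 <= B by apply: le_trans (f_bound (\row_i 0)).
have mX u := @measurable_coordinate R u.
have mstep i : measurable_fun setT
    (fun w : Dspace R => step m (fun q => ratr q < coordinate (s i) w) : R).
  apply: measurable_step => q; apply: measurable_superlevel; exact: mX.
pose f1 (w : Dspace R) := f (\row_i coordinate (t i) w).
pose f2 (w : Dspace R) := f (\row_i step m (fun q => ratr q < coordinate (s i) w)).
have if1 : P.-integrable setT (EFin \o f1).
  apply: (@integrable_bounded _ _ _ _ _ B) => //.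
    by apply: measurable_row_fun => // i; exact: mX.
  by move=> w; exact: f_bound.
have if2 : P.-integrable setT (EFin \o f2).
  apply: (@integrable_bounded _ _ _ _ _ B) => //.
    by apply: measurable_row_fun => // i; exact: mstep.
  by move=> w; exact: f_bound.
have i12 := integrableB measurableT if1 if2.
rewrite -(RintegralB measurableT if1 if2).
apply: le_trans (Rintegral_le_norm i12) _.
have iN u : P.-integrable setT (EFin \o (fun w : Dspace R => `|coordinate u w| / K)).
  rewrite (_ : (fun w => _) = (fun w => K^-1 * `|coordinate u w|)).
    apply: (@integrable_bounded_mul _ _ _ _ (cst K^-1) _ `|K^-1|) => //.
    exact: (integrable_norm (iX u)).
  by apply/funext => w; rewrite mulrC.
have ib i : P.-integrable setT (EFin \o
    (fun w : Dspace R => k * bregman (coordinate (t i) w) (coordinate (s i) w))).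
  apply: (@integrable_bounded_mul _ _ _ _ (cst k) _ `|k|) => //.
  exact: (integrable_bregman qP).
pose T i w := `|coordinate (t i) w| / K + `|coordinate (s i) w| / K +
  k * bregman (coordinate (t i) w) (coordinate (s i) w).
have iT i : P.-integrable setT (EFin \o T i).
  exact: (integrableD measurableT (integrableD measurableT (iN (t i)) (iN (s i))) (ib i)).
have iS := integrable_real_sum (index_enum 'I_d) iT.
have iBS : P.-integrable setT (EFin \o (fun w => 2 * B * \sum_i T i w)).
  by apply: (@integrable_bounded_mul _ _ _ _ (cst (2 * B)) _ `|2 * B|).
have ie : P.-integrable setT (EFin \o cst e).
  by apply: (@integrable_bounded _ _ _ _ (cst e) `|e|).
apply: (@le_trans _ _ (\int[P]_w (e + 2 * B * \sum_i T i w))).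
  apply: le_Rintegral => //.
  - exact: (integrable_norm i12).
  - exact: (integrableD measurableT ie iBS).
  move=> w _; apply: (proximity_bound (r := r)) => // i zK.
  by apply: le_lt_trans mr; apply: step_dist => //; exact: le_trans zK Km.
rewrite (RintegralD measurableT ie iBS) Rintegral_probability_cst lerD2l.
rewrite (RintegralZl _ measurableT iS) ler_wpM2l ?mulr_ge0//.
rewrite Rintegral_sum//; apply: ler_sum => i _.
rewrite (RintegralD measurableT (integrableD measurableT (iN (t i)) (iN (s i))) (ib i)).
rewrite (RintegralD measurableT (iN (t i)) (iN (s i))).
rewrite (RintegralZl _ measurableT (integrable_bregman qP (t i) (s i))).
rewrite !(RintegralZr _ measurableT (integrable_norm (iX _))).
by rewrite !lerD// ?ler_wpM2r ?invr_ge0 ?(ltW K0)// ?(Rintegral_norm_le_energy qP)//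
  ler_wpM2l// (Rintegral_bregman_le qP).
Qed.

End proximity.

Section fdd_limit.
Context {R : realType} (P : nat -> probability (Dspace R) R)
  (V : nat -> {nonneg R} -> R).
Hypothesis qP : forall n, quasimartingale (P n) (V n).
Hypothesis energy_bounded : forall N : nat, exists C : R, forall n,
  energy (P n) (V n) (nat_time R N) <= C.
Context (g : rat -> R).
Hypothesis g_lim : forall s : rat,
  energy (P n) (V n) (rat_time R s) @[n --> \oo] --> g s.
Context d (Om : measurableType d) (mu : probability Om R)
  (c : rat * rat -> Om -> bool).
Hypothesis mc : forall j, measurable [set u | c j u].
Hypothesis c_lim : forall (js : seq (rat * rat)) (F : seq bool -> R),
  \int[P n]_w F [seq rat_bit j w | j <- js] @[n --> \oo] -->
  \int[mu]_u F [seq c j u | j <- js].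
Context (Psi : Om -> Dspace R).
Hypothesis mPsi : measurable_fun setT Psi.
Hypothesis reg : {ae mu, forall u, regular_code (fun s q => c (s, q) u)}.
Hypothesis Psi_values : {ae mu, forall u,
  right_values (fun s q => c (s, q) u) (fun t => coordinate t (Psi u))}.

Lemma energy_limit_mono s s' : 0 <= s -> s <= s' -> g s <= g s'.
Proof.
move=> s0 ss'; apply: (ler_cvg_to (@g_lim s) (@g_lim s')); apply: nearW => n.
apply: energy_nondecreasing => //=.
by rewrite !ger0_norm ?ler0q ?ler_rat// (le_trans s0).
Qed.

Context (k : nat) (f : 'rV[R]_k -> R) (B : R) (t : 'I_k -> {nonneg R}).
Hypotheses (f_cont : continuous f) (f_bound : forall x, `|f x| <= B).

Let B0 : 0 <= B. Proof. by apply: le_trans (f_bound (\row_i 0)). Qed.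

Let codes (s : 'I_k -> rat) m (b : rat * rat -> bool) : R :=
  f (\row_i step m (fun q => b (s i, q))).

Lemma step_limit (s : 'I_k -> rat) m :
  \int[P n]_w codes s m (fun j => rat_bit j w) @[n --> \oo] -->
  \int[mu]_u codes s m (fun j => c j u).
Proof.
have [G GE] := local_to_seq (@row_step_local R k _ s _ f m).
have -> : \int[mu]_u codes s m (fun j => c j u) = \int[mu]_u G [seq c j u | j <-
    [seq (s i, grid_level m j) | i <- enum 'I_k, j <- iota 0 (2 * m * m.+1)]].
  by apply: eq_Rintegral => u _; exact: GE.
rewrite (_ : (fun n => _) = (fun n => \int[P n]_w G [seq rat_bit j w | j <-
    [seq (s i, grid_level m j) | i <- enum 'I_k, j <- iota 0 (2 * m * m.+1)]])).
  exact: c_lim.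
by apply/funext => n; apply: eq_Rintegral => w _; exact: GE.
Qed.

(** Times tend to [t] from the right while the levels become dense. By [right_values] the bits at
    each level other than the value are eventually decided, so the steps converge to the path, and
    [f] is bounded. *)
Lemma step_path_limit (s : nat -> 'I_k -> rat) :
  (forall m i, (t i)%:num < ratr (s m i) < (t i)%:num + m.+1%:R^-1) ->
  \int[mu]_u codes (s m) m (fun j => c j u) @[m --> \oo] -->
  \int[mu]_u f (\row_i coordinate (t i) (Psi u)).
Proof.
move=> st.
have Fae : Filter (nbhs (almost_everywhere mu)) := ae_filter_ringOfSetsType mu.
have mcodes m : measurable_fun setT (fun u => codes (s m) m (fun j => c j u)).
  move=> _ Y _; rewrite setTI.
  exact: (discrete_measurable_local (F := codes (s m) m) mc (@row_step_local R k _ (s m) _ f m)).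
have mlim : measurable_fun setT (fun u => f (\row_i coordinate (t i) (Psi u))).
  apply: measurable_row_fun => // i.
  exact: measurableT_comp (@measurable_coordinate R (t i)) mPsi.
have [] := @dominated_convergence _ _ _ mu _ measurableT
  (fun m u => (codes (s m) m (fun j => c j u))%:E)
  (fun u => (f (\row_i coordinate (t i) (Psi u)))%:E) (cst B%:E).
- by move=> m; exact/measurable_EFinP.
- exact/measurable_EFinP.
- apply: filterS2 reg Psi_values => u [c1 _ _] v _.
  apply/cvg_EFin; first exact: nearW.
  apply: row_cvg => // i; apply: step_cvg.
  + by move=> m q q'; exact: c1.
  + move=> q /(v (t i) q).1 [e e0 h].
    have [m0 m0P] := inv_nat_lt e0.
    near=> m; apply: h; have /andP[-> h2] := st m i.
    apply: lt_trans h2 _; rewrite ltrD2l; apply: m0P.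
    by near: m; exact: nbhs_infty_ge.
  + move=> q /(v (t i) q).2 [e e0 h].
    have [m0 m0P] := inv_nat_lt e0.
    near=> m; apply: h; have /andP[-> h2] := st m i.
    apply: lt_trans h2 _; rewrite ltrD2l; apply: m0P.
    by near: m; exact: nbhs_infty_ge.
- by apply: (@integrable_bounded _ _ _ _ (cst B) `|B|).
- by apply: aeW => u m _ /=; rewrite lee_fin; exact: f_bound.
move=> iL _ h; apply: fine_cvg.
rewrite fineK; first exact: h.
exact: (integrable_fin_num measurableT iL).
Unshelve. all: by end_near. Qed.

(** The error has four parts: resolution in the limit space (e / 8), limit in n at this resolution
    (e / 8), modulus of continuity of [f] (e / 4), energy terms of [proximity_expectation] (e /
    2). *)
Lemma fdd_limit : (forall i, continuity_time g (t i)%:num) ->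
  \int[P n]_w f (\row_i coordinate (t i) w) @[n --> \oo] -->
  \int[mu]_u f (\row_i coordinate (t i) (Psi u)).
Proof.
move=> ct; apply/cvgrPdist_le => e e0.
have [N tN] : exists N : nat, forall i, (t i)%:num + 1 <= N%:R.
  have [N hN] := nat_ge (\sum_i (t i)%:num + 1); exists N => i.
  apply: le_trans hN; rewrite lerD2r (bigD1 i)//= lerDl.
  by apply: sumr_ge0.
have [C0 CP] := energy_bounded N.
pose C := `|C0|.
have energy_le_C n (s : {nonneg R}) : s%:num <= N%:R -> energy (P n) (V n) s <= C.
  move=> sN; apply: le_trans (ler_norm C0); apply: le_trans (CP n).
  exact: energy_nondecreasing.
pose D : R := k%:R.
have D0 : 0 <= D by exact: ler0n.
have C_ge0 : 0 <= C by exact: normr_ge0.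
(* Makes the tail terms, 2 B D (2 C / K), at most e / 4; the added 1s keep [K] positive. *)
pose K := 16 * (B + 1) * (D + 1) * (C + 1) / e.
have K0 : 0 < K by rewrite divr_gt0// !mulr_gt0// ltr_wpDl.
have e40 : 0 < e / 4 by rewrite divr_gt0.
have [r r0 fr] := uniformly_continuous_box K f_cont e40.
pose kap := 2 * (1 + K) ^+ 3 / (r / 2) ^+ 2.
have kap0 : 0 < kap.
  by rewrite divr_gt0 ?exprn_gt0 ?divr_gt0// mulr_gt0// exprn_gt0// addr_gt0.
(* An energy increment so small that the divergence terms, 2 B D kap eta, are at most e / 4. *)
pose eta := e / (8 * (B + 1) * (D + 1) * kap).
have B1 : 0 < B + 1 by rewrite ltr_wpDl.
have D1 : 0 < D + 1 by rewrite ltr_wpDl.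
have eta0 : 0 < eta.
  by apply: divr_gt0 => //; apply: mulr_gt0 => //; rewrite !mulr_gt0.
have /choice[sm smP] : forall i, exists s : rat * rat,
    [/\ 0 <= s.1, ratr s.1 < (t i)%:num, (t i)%:num < ratr s.2 & g s.2 - g s.1 < eta].
  by move=> i; have [_ /(_ _ eta0)[s [s' h]]] := ct i; exists (s, s').
have /choice[sq sqP] : forall mi : nat * 'I_k, exists s : rat,
    (t mi.2)%:num < ratr s < (t mi.2)%:num + mi.1.+1%:R^-1.
  move=> [m i]; have [|s] := @rat_in_itvoo R (t i)%:num ((t i)%:num + m.+1%:R^-1).
    by rewrite ltrDl.
  by rewrite in_itv; exists s.
have e80 : 0 < e / 8 by rewrite divr_gt0.
have /cvgrPdist_le/(_ _ e80) L1 :=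
  step_path_limit (s := fun m i => sq (m, i)) (fun m i => sqP (m, i)).
have [m1 m1P] := inv_nat_lt (divr_gt0 r0 (ltr0n R 2)).
have [m2 m2P] := nat_ge K.
have L2 : \forall m \near \oo, forall i, sq (m, i) <= (sm i).2.
  apply: filter_forall => i; have [_ _ h _] := smP i.
  have h' : 0 < ratr (sm i).2 - (t i)%:num by rewrite subr_gt0.
  have [m3 m3P] := inv_nat_lt h'.
  near=> m; rewrite -(ler_rat R); have /andP[_ /ltW] := sqP (m, i); move/le_trans; apply.
  rewrite -lerBrDl; apply/ltW/m3P; near: m; exact: nbhs_infty_ge.
have [m [mL1 mL2 mm1 mm2]] : exists m, [/\
    `|\int[mu]_u f (\row_i coordinate (t i) (Psi u)) -
      \int[mu]_u codes (fun i => sq (m, i)) m (fun j => c j u)| <= e / 8,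
    forall i, sq (m, i) <= (sm i).2, (m1 <= m)%N & (m2 <= m)%N].
  near \oo => m; exists m; split; near: m => //; exact: nbhs_infty_ge.
have /cvgrPdist_le/(_ _ e80) L3 := @step_limit (fun i => sq (m, i)) m.
(* The limit [g] is known at rational times only, so the energy at [t i] is bounded below by that at
   the earlier rational [(sm i).1]. *)
have L4 : \forall n \near \oo, forall i,
    energy (P n) (V n) (rat_time R (sq (m, i))) -
    energy (P n) (V n) (rat_time R (sm i).1) < eta.
  apply: filter_forall => i.
  have [s0 st ts gs] := smP i.
  apply: (cvgr_lt (g (sq (m, i)) - g (sm i).1)).
    by apply: cvgB; exact: g_lim.
  apply: le_lt_trans gs; rewrite lerD2r; apply: energy_limit_mono => //.
  have /andP[/ltW h _] := sqP (m, i).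
  by rewrite -(ler0q R); apply: le_trans h.
near=> n.
have L3n : `|\int[mu]_u codes (fun i => sq (m, i)) m (fun j => c j u) -
   \int[P n]_w codes (fun i => sq (m, i)) m (fun j => rat_bit j w)| <= e / 8 by near: n.
have L4n : forall i, energy (P n) (V n) (rat_time R (sq (m, i))) -
    energy (P n) (V n) (rat_time R (sm i).1) < eta by near: n.
have sq_num i : (rat_time R (sq (m, i)))%:num = ratr (sq (m, i)).
  apply: ger0_norm; have /andP[/ltW h _] := sqP (m, i).
  exact: le_trans h.
have tsq i : (t i)%:num <= (rat_time R (sq (m, i)))%:num.
  by rewrite sq_num; have /andP[/ltW] := sqP (m, i).
have Km : K <= m%:R by apply: le_trans m2P _; rewrite ler_nat.
have := proximity_expectation (qP n) f_cont f_bound K0 r0 (ltW e40) Km (m1P m mm1) fr tsq.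
rewrite -/kap; set S := \sum_i _ => prox.
have SB : S <= D * (2 * C / K + kap * eta).
  have -> : D * (2 * C / K + kap * eta) = \sum_(i < k) (2 * C / K + kap * eta).
    by rewrite sumr_const card_ord /D mulr_natl.
  apply: ler_sum => i _.
  have E1 : energy (P n) (V n) (t i) <= C.
    by apply: energy_le_C; apply: le_trans (tN i); rewrite lerDl.
  have E2 : energy (P n) (V n) (rat_time R (sq (m, i))) <= C.
    apply: energy_le_C; apply: le_trans (tN i); rewrite sq_num.
    have /andP[_ /ltW /le_trans] := sqP (m, i); apply.
    by rewrite lerD2l invf_le1// ler1n.
  have E3 : energy (P n) (V n) (rat_time R (sm i).1) <= energy (P n) (V n) (t i).
    apply: energy_nondecreasing => //=; have [s0 st _ _] := smP i.
    by rewrite ger0_norm ?ler0q// ltW.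
  apply: lerD.
    by rewrite -mulrDl ler_wpM2r ?invr_ge0 ?(ltW K0)//; lra.
  by rewrite ler_pM2l//; have := L4n i; lra.
have frac (x : R) : 0 <= x -> 0 <= x / (x + 1) <= 1.
  move=> x0; have x1 : 0 < x + 1 by rewrite ltr_wpDl.
  by rewrite divr_ge0 ?(ltW x1)//= ler_pdivrMr// mul1r lerDl.
have S1 : 2 * B * (D * (2 * C / K)) <= e / 4.
  have -> : 2 * B * (D * (2 * C / K)) = B / (B + 1) * (D / (D + 1)) * (C / (C + 1)) * (e / 4).
    by rewrite /K; field; rewrite !lt0r_neq0// ltr_wpDl.
  rewrite ler_piMl ?(ltW e40)//.
  have /andP[a1 a2] := frac B B0; have /andP[b1 b2] := frac D D0.
  have /andP[c1 c2] := frac C C_ge0.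
  by apply: mulr_ile1 => //; [apply: mulr_ge0|apply: mulr_ile1].
have S2 : 2 * B * (D * (kap * eta)) <= e / 4.
  have -> : 2 * B * (D * (kap * eta)) = B / (B + 1) * (D / (D + 1)) * (e / 4).
    by rewrite /eta; field; rewrite !lt0r_neq0// ltr_wpDl.
  rewrite ler_piMl ?(ltW e40)//.
  have /andP[a1 a2] := frac B B0; have /andP[b1 b2] := frac D D0.
  exact: mulr_ile1.
have S3 : 2 * B * S <= e / 2.
  apply: (@le_trans _ _ (2 * B * (D * (2 * C / K + kap * eta)))).
    by rewrite ler_wpM2l// mulr_ge0.
  by rewrite !mulrDr; lra.
set a1 := \int[mu]_u f _ in mL1 *.
set a2 := \int[mu]_u codes _ _ _ in mL1 L3n.
set a3 := \int[P n]_w codes _ _ _ in L3n.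
set a4 := \int[P n]_w f _ in prox *.
have prox' : `|a4 - a3| <= e / 4 + 2 * B * S by exact: prox.
move: mL1 L3n prox'; rewrite !ler_norml => /andP[p1 p2] /andP[p3 p4] /andP[p5 p6].
by apply/andP; split; lra.
Unshelve. all: by end_near. Qed.

End fdd_limit.

Lemma expectation_bounded d (T : measurableType d) (R : realType)
    (P : probability T R) (h : T -> R) (C : R) :
  measurable_fun setT h -> (forall x, `|h x| <= C) ->
  'E_P[h]%E = (\int[P]_x h x)%:E.
Proof.
move=> mh hC; rewrite unlock fineK//.
exact: (integrable_fin_num measurableT (@integrable_bounded _ _ _ P h C mh hC)).
Qed.

Theorem theorem1p5 (R : realType) (P : nat -> probability (Dspace R) R)
    (M A : nat -> {nonneg R} -> Dspace R -> R)
    (M_martingale : forall n, martingale (P n) (M n))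
    (M_cadlag : forall n, {ae P n, forall w, cadlag (fun t => M n t w)})
    (A_adapted : forall n, adapted (A n))
    (A_variation : forall n,
      {ae P n, forall w, locally_finite_variation (fun t => A n t w)})
    (decomposition : forall n,
      {ae P n, forall w, forall t, coordinate t w = M n t w + A n t w})
    (moments_bounded : forall t : {nonneg R}, exists C : R, forall n,
      ('E_(P n)[fun w => (`|coordinate t w|)%R] +
       \int[P n]_w variation_upto t (fun s => A n s w) <= C%:E)%E) :
  exists (k : nat -> nat) (Q : probability (Dspace R) R),
    {homo k : i j / (i < j)%N} /\ fdd_cvg_ae (P \o k) Q.
Proof.
pose V n t := fine (\int[P n]_w variation_upto t (fun s => A n s w)).
have qP n : quasimartingale (P n) (V n).
  apply: (decomposition_quasimartingale (M_martingale n)) => // t.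
  by have [C hC] := moments_bounded t; apply: le_lt_trans (hC n) (ltry _).
have energy_bounded t : exists C : R, forall n, energy (P n) (V n) t <= C.
  (* Both terms are nonnegative, so [C] bounds each of them, and [energy_le] gives 1 + C + 3 C. *)
  have [C hC] := moments_bounded t; exists (1 + C + 3 * C) => n.
  have e0 : (0 <= 'E_(P n)[fun w => (`|coordinate t w|)%R])%E.
    exact: expectation_ge0.
  have i0 : (0 <= \int[P n]_w variation_upto t (fun s => A n s w))%E.
    by apply: integral_ge0 => w _; exact: total_variation_ge0.
  have eC := le_trans (leeDl _ i0) (hC n).
  have iC := le_trans (leeDr _ e0) (hC n).
  apply: le_trans (energy_le (qP n) t) _.
  have h1 : \int[P n]_w `|coordinate t w| <= C.
    rewrite /Rintegral -lee_fin fineK; first by move: eC; rewrite unlock.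
    by move: e0 eC; rewrite unlock => /ge0_fin_numE -> /le_lt_trans; apply; exact: ltry.
  have h2 : V n t <= C.
    rewrite /V -lee_fin fineK//.
    by rewrite ge0_fin_numE//; apply: le_lt_trans iC (ltry _).
  by rewrite lerD// ?lerD2l// ler_pM2l.
have abs_energy_bounded (s : rat) : exists C : R, forall n,
    `|energy (P n) (V n) (rat_time R s)| <= C.
  have [C hC] := energy_bounded (rat_time R s); exists C => n.
  rewrite ger0_norm//; apply: le_trans (Rintegral_norm_le_energy (qP n) _).
  exact: Rintegral_ge0.
have [k [k_incr [g [g_lim [d [Om [mu [c [mc c_lim]]]]]]]]] :=
  bits_limit P (@measurable_rat_bit R) abs_energy_bounded.
have qPk n : quasimartingale ((P \o k) n) ((V \o k) n) by exact: qP.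
have bk (N : nat) : exists C : R, forall n,
    energy ((P \o k) n) ((V \o k) n) (nat_time R N) <= C.
  by have [C hC] := energy_bounded (nat_time R N); exists C => n; exact: hC.
have reg := ae_regular_code qPk bk mc c_lim.
have [Psi mPsi valPsi] := limit_path mc reg.
have [Q QE] := pushforward_probability mu mPsi.
exists k, Q; split => //.
exists [set t : {nonneg R} | continuity_time g t%:num].
  have cD := @countable_discontinuity_times R g (energy_limit_mono qPk g_lim).
  exists [set t | 0 <= t /\ ~ continuity_time g t]; split.
  - exact: countable_measurable.
  - exact: countable_lebesgue_measure0.
  - by move=> _ [t nt <-].
move=> l t ct f f_cont f_bdd.
have [B fB] : exists B : R, forall x, `|f x| <= B.
  have [B [_ hB]] := f_bdd; exists (B + 1) => x.
  by apply: hB => //; rewrite ltrDl.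
have mf : measurable_fun setT (fun w : Dspace R => f (\row_i coordinate (t i) w)).
  by apply: measurable_row_fun => // i; exact: measurable_coordinate.
have bf (w : Dspace R) : `|f (\row_i coordinate (t i) w)| <= B by exact: fB.
rewrite (expectation_bounded Q mf bf).
under eq_fun do rewrite (expectation_bounded _ mf bf).
apply/cvg_EFin; first exact: nearW.
rewrite (QE _ B mf bf).
exact: (fdd_limit qPk bk g_lim mc c_lim mPsi reg valPsi f_cont fB ct).
Qed.
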